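(* Let $q:\mathbb R^{n+m}\to\mathbb R$, let $\eta,\mu>0$, and let $(x,y)\in\mathbb R^n\times\mathbb R^m$. (a) If $q\in\mathcal C^0(\mathbb R^{n+m};L_{0,q})$, then $|q_{\eta,\mu}(x,y)-q(x,y)|\le L_{0,q}(\eta^2n+\mu^2m)^{1/2}$. (b) If $q\in\mathcal C^1(\mathbb R^{n+m};L_{1,q})$, then $|q_{\eta,\mu}(x,y)-q(x,y)|\le\frac{L_{1,q}}{2}(\eta^2n+\mu^2m)$. Moreover $\|\nabla q_{\eta,\mu}(x,y)-\nabla q(x,y)\|\le U_x^{(1)}+U_y^{(1)}$, where $$U_x^{(1)}=\frac{L_{1,q}}2\Big(\eta(n+3)^{3/2}+\frac{\mu^2}{\eta}mn^{1/2}\Big),\qquad U_y^{(1)}=\frac{L_{1,q}}2\Big(\frac{\eta^2}{\mu}nm^{1/2}+\mu(m+3)^{3/2}\Big).$$ (c) If $q\in\mathcal C^2(\mathbb R^{n+m};L_{2,q})$, then $\|\nabla q_{\eta,\mu}(x,y)-\nabla q(x,y)\|\le U_x^{(2)}+U_y^{(2)}$, where $$U_x^{(2)}=\frac{2L_{2,q}}3\Big(\eta^2(n+4)^2+\frac{\mu^3}{\eta}(m+3)^{3/2}n^{1/2}\Big),\qquad U_y^{(2)}=\frac{2L_{2,q}}3\Big(\frac{\eta^3}{\mu}(n+3)^{3/2}m^{1/2}+\mu^2(m+4)^2\Big).$$ Moreover $\|\nabla^2q_{\eta,\mu}(x,y)-\nabla^2q(x,y)\|\le U_{xx}^{(2)}+U_{xy}^{(2)}+U_{yy}^{(2)}$,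 where $$U_{xx}^{(2)}=\frac{2L_{2,q}}3\Big(\eta(n+5)^{5/2}+\eta(n+3)^{3/2}+\frac{\mu^3}{\eta^2}(n+1)(m+3)^{3/2}\Big),$$ $$U_{yy}^{(2)}=\frac{2L_{2,q}}3\Big(\mu(m+5)^{5/2}+\mu(m+3)^{3/2}+\frac{\eta^3}{\mu^2}(m+1)(n+3)^{3/2}\Big),$$ $$U_{xy}^{(2)}=\frac{2L_{2,q}}3\Big(\frac{\eta^2}{\mu}(n+4)^2m^{1/2}+\frac{\mu^2}{\eta}(m+4)^2n^{1/2}\Big).$$
   Context: $m,n\ge1$. The Gaussian smoothing of $q$ is $q_{\eta,\mu}(x,y)=\mathbb E_{u,v}[q(x+\eta u,y+\mu v)]$, where $u\sim\mathcal N(0,I_n)$, $v\sim\mathcal N(0,I_m)$ are independent. $\mathcal C^i(S;L_{i,q})$ is the class of $i$ times differentiable functions whose $i$-th derivative ($q$ itself, $\nabla q$, $\nabla^2q$ for $i=0,1,2$) is Lipschitz on $S$ with constant $L_{i,q}$. Norms are Euclidean for vectors and operator (spectral) norms for matrices. *)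

(* Defs.v *)
From HB Require Import structures.
From mathcomp Require Import all_boot all_order all_algebra.
From mathcomp Require Import all_classical all_reals all_analysis.
Set Implicit Arguments.
Unset Strict Implicit.
Unset Printing Implicit Defensive.
Import Order.TTheory GRing.Theory Num.Theory.
Import numFieldNormedType.Exports.
Local Open Scope classical_set_scope.
Local Open Scope ring_scope.

(* The library norm `|_| on 'rV[R]_k and 'M[R]_k is the sup norm; it is used
   here only for the topology and differentiability. *)
Definition enorm (R : realType) (k : nat) (v : 'rV[R]_k) : R :=
  Num.sqrt (\sum_(i < k) v 0 i ^+ 2).

(* A matrix acts on row vectors by v |-> v *m A. *)
Definition opnorm (R : realType) (k : nat) (A : 'M[R]_k) : R :=
  sup [set enorm (v *m A) | v in [set v : 'rV[R]_k | enorm v <= 1]].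

Definition grad (R : realType) (k : nat) (f : 'rV[R]_k -> R) (z : 'rV[R]_k) :
    'rV[R]_k :=
  \row_i 'D_(delta_mx 0 i) f z.

(* The entry (i, j) is d_i (d_j f). *)
Definition hessian (R : realType) (k : nat) (f : 'rV[R]_k -> R)
    (z : 'rV[R]_k) : 'M[R]_k :=
  jacobian (grad f) z.

Definition classC0 (R : realType) (k : nat) (L : R) (f : 'rV[R]_k -> R) : Prop :=
  forall z w, `|f z - f w| <= L * enorm (z - w).

Definition classC1 (R : realType) (k : nat) (L : R) (f : 'rV[R]_k -> R) : Prop :=
  (forall z, differentiable f z) /\
  (forall z w, enorm (grad f z - grad f w) <= L * enorm (z - w)).

Definition classC2 (R : realType) (k : nat) (L : R) (f : 'rV[R]_k -> R) : Prop :=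
  [/\ (forall z, differentiable f z),
      (forall z, differentiable (grad f) z) &
      (forall z w, opnorm (hessian f z - hessian f w) <= L * enorm (z - w))].

Section gaussian.
Context (R : realType).

Local Notation mR := (measurableTypeR R).

Definition tcons (n : nat) (w : mR * n.-tuple mR) : n.+1.-tuple mR :=
  [tuple of w.1 :: w.2].

Lemma measurable_tcons (n : nat) :
  measurable_fun [set: mR * n.-tuple mR] (@tcons n).
Proof. exact: measurable_cons. Qed.

HB.instance Definition _ (n : nat) :=
  isMeasurableFun.Build _ _ _ _ (@tcons n) (@measurable_tcons n).

(* N(0, I_n), as the n-fold product of N(0, 1); n.-tuple mR carries the product
   sigma-algebra, whereas 'rV[R]_n has no canonical one. *)
Fixpoint std_gaussian (n : nat) : probability (n.-tuple mR) R :=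
  match n with
  | 0 => dirac [tuple]
  | n'.+1 => distribution (normal_prob 0 1 \x std_gaussian n')%E (@tcons n')
  end.

End gaussian.

Definition rowt (R : realType) (n : nat) (t : n.-tuple R) : 'rV[R]_n :=
  \row_i tnth t i.

Definition perturbed (R : realType) (n m : nat) (q : 'rV[R]_(n + m) -> R)
    (eta mu : R) (z : 'rV[R]_(n + m))
    (w : n.-tuple (measurableTypeR R) * m.-tuple (measurableTypeR R)) : R :=
  q (row_mx (lsubmx z + eta *: rowt w.1) (rsubmx z + mu *: rowt w.2)).

(* Independence of u and v: their joint law is the product measure. *)
Definition smoothing (R : realType) (n m : nat) (q : 'rV[R]_(n + m) -> R)
    (eta mu : R) (z : 'rV[R]_(n + m)) : R :=
  \int[(std_gaussian R n \x std_gaussian R m)%E]_w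
    perturbed q eta mu z w.

(* The integral above is total (0 or junk for a non-integrable integrand), so
   the existence of the expectation is a separate assertion. *)
Definition smoothable (R : realType) (n m : nat) (q : 'rV[R]_(n + m) -> R)
    (eta mu : R) (z : 'rV[R]_(n + m)) : Prop :=
  (std_gaussian R n \x std_gaussian R m)%E.-integrable setT
    (EFin \o perturbed q eta mu z).

(* Main.v *)
Require Import Defs.
From HB Require Import structures.
From mathcomp Require Import all_boot all_order all_algebra.
From mathcomp Require Import all_classical all_reals all_analysis.
From mathcomp Require Import measurable_realfun ring lra.
Import Order.TTheory GRing.Theory Num.Theory.
Import numFieldNormedType.Exports.
Set Implicit Arguments.
Unset Strict Implicit.
Unset Printing Implicit Defensive.
Local Open Scope classical_set_scope.
Local Open Scope ring_scope.

(** Write [Z] for the noise [(eta u, mu v)], so that the smoothing of [q] is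
    [z |-> E q(z + Z)], and put [s^2 = E |Z|^2 = eta^2 n + mu^2 m].  The
    Gaussian law enters through three facts: the coordinates of [Z] have mean
    zero, their squares have total mean at most [s^2], and their fourth powers
    are integrable.

    - If [f] is [L]-Lipschitz, then [|E f(z + Z) - f z| <= L E|Z| <= L s]
      ([mollify_classC0]).
    - If the gradient of [f] is [L]-Lipschitz, Taylor's formula gives
      [|f(z + Z) - f z - <grad f z, Z>| <= L/2 |Z|^2]; the linear term has mean
      zero, so [|E f(z + Z) - f z| <= L/2 s^2] ([mollify_classC1]).
    - Smoothing commutes with directional derivatives
      ([mollify_differentiable]).  If the gradient has a local Lipschitz constant
      of linear growth, the first-order remainder of [f] at [z + Z] is quadratic
      in the increment with an integrable constant, and integrating it yields the
      differentiability of the smoothed function.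

    Every derivative bound then reduces to one of the two value bounds, applied
    to a directional derivative of [q].  For [q] of class [C^1] the derivative
    ['D_e q] is [L|e|]-Lipschitz, so the gradients are within [L s] of each other.
    For [q] of class [C^2], ['D_e q] is of class [C^1] with constant [L|e|] and
    ['D_v ('D_e q)] is [L|v||e|]-Lipschitz, so the gradients are within
    [L/2 s^2] and the Hessians within [L s].  Duality turns these scalar estimates
    into bounds on the Euclidean and the operator norm
    ([mollify_bounds_classC1], [mollify_bounds_classC2]).  The constants obtained
    are smaller than the stated ones, because
    [s <= eta n^(1/2) + mu m^(1/2)] and [2 a^(1/2) <= (a + c)^p] for
    [c, p >= 1]. *)

(** * Euclidean norm and inner product on row vectors *)

Definition dot (R : realType) (k : nat) (u v : 'rV[R]_k) : R :=
  \sum_(i < k) u 0 i * v 0 i.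

Section euclidean.
Context (R : realType) (k : nat).
Implicit Types (u v w : 'rV[R]_k) (a C : R).

Lemma dotC u v : dot u v = dot v u.
Proof. by apply: eq_bigr => i _; rewrite mulrC. Qed.

Lemma dotDl u v w : dot (u + v) w = dot u w + dot v w.
Proof. by rewrite -big_split; apply: eq_bigr => i _; rewrite mxE mulrDl. Qed.

Lemma dotZl a u v : dot (a *: u) v = a * dot u v.
Proof. by rewrite mulr_sumr; apply: eq_bigr => i _; rewrite mxE mulrA. Qed.

Lemma dot0l v : dot 0 v = 0.
Proof. by rewrite /dot big1// => i _; rewrite mxE mul0r. Qed.

Lemma dotBl u v w : dot (u - v) w = dot u w - dot v w.
Proof. by rewrite -[- v]scaleN1r dotDl dotZl mulN1r. Qed.

Lemma dotDr u v w : dot u (v + w) = dot u v + dot u w.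
Proof. by rewrite dotC dotDl !(dotC u). Qed.

Lemma dotZr a u v : dot u (a *: v) = a * dot u v.
Proof. by rewrite dotC dotZl dotC. Qed.

Lemma enorm_ge0 v : 0 <= enorm v. Proof. exact: sqrtr_ge0. Qed.

Lemma enorm_sqr v : enorm v ^+ 2 = dot v v.
Proof. by rewrite sqr_sqrtr// sumr_ge0// => i _; rewrite sqr_ge0. Qed.

Lemma enorm_coord v i : `|v 0 i| <= enorm v.
Proof.
rewrite -sqrtr_sqr ler_wsqrtr// (bigD1 i)//= lerDl sumr_ge0// => j _.
exact: sqr_ge0.
Qed.

Lemma enorm0 : enorm (0 : 'rV[R]_k) = 0.
Proof. by rewrite /enorm big1 ?sqrtr0// => i _; rewrite mxE expr0n. Qed.

Lemma enorm_eq0 v : enorm v = 0 -> v = 0.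
Proof.
move=> v0; apply/rowP => i; rewrite mxE; apply/normr0_eq0/eqP.
by rewrite -normr_le0 normr_id -v0 enorm_coord.
Qed.

Lemma enormZ a v : enorm (a *: v) = `|a| * enorm v.
Proof.
apply/eqP; rewrite -(eqrXn2 (ltn0Sn 1)) ?mulr_ge0 ?enorm_ge0//.
by rewrite exprMn !enorm_sqr dotZl dotZr mulrA -expr2 real_normK ?num_real.
Qed.

Lemma enormN v : enorm (- v) = enorm v.
Proof. by rewrite -scaleN1r enormZ normrN1 mul1r. Qed.

Lemma cauchy_schwarz u v : `|dot u v| <= enorm u * enorm v.
Proof.
have [/enorm_eq0 ->|v0] := eqVneq (enorm v) 0.
  by rewrite dotC dot0l normr0 mulr_ge0 ?enorm_ge0.
have vgt0 : 0 < enorm v by rewrite lt_neqAle eq_sym v0 enorm_ge0.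
rewrite -(@ler_pXn2r _ 2) ?nnegrE ?mulr_ge0 ?enorm_ge0//.
rewrite real_normK ?num_real// exprMn -(ler_pM2r (exprn_gt0 2 vgt0)).
(* the square norm of |v|^2 u - <u, v> v is |v|^2 (|u|^2 |v|^2 - <u, v>^2) *)
have := sqr_ge0 (enorm ((enorm v ^+ 2) *: u - dot u v *: v)).
rewrite (enorm_sqr (_ - _)) -scaleNr !(dotDl, dotDr, dotZl, dotZr) (dotC v u) -!enorm_sqr.
set b := dot u v; set p := enorm u; set q := enorm v => h.
have : 0 <= q ^+ 2 * (p ^+ 2 * q ^+ 2 - b ^+ 2) by lra.
nra.
Qed.

Lemma enormD u v : enorm (u + v) <= enorm u + enorm v.
Proof.
rewrite -(@ler_pXn2r _ 2) ?nnegrE ?addr_ge0 ?enorm_ge0//.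
rewrite enorm_sqr !(dotDl, dotDr) (dotC v u) sqrrD -!enorm_sqr.
have := le_trans (ler_norm _) (cauchy_schwarz u v); lra.
Qed.

Lemma enorm_dual C v : 0 <= C ->
  (forall e, dot v e <= C * enorm e) -> enorm v <= C.
Proof.
move=> C0 /(_ v); rewrite -enorm_sqr expr2.
have [-> //|v0] := eqVneq (enorm v) 0.
by rewrite ler_pM2r// lt_neqAle eq_sym v0 enorm_ge0.
Qed.

Lemma enorm_le_norm v : enorm v <= k%:R * `|v|.
Proof.
have h i : `|v 0 i| <= `|v|.
  by rewrite {2}/Num.Def.normr/= mx_normrE; apply: (le_bigmax _ _ (0, i)).
rewrite -(@ler_pXn2r _ 2) ?nnegrE ?mulr_ge0 ?enorm_ge0//.
rewrite enorm_sqr (@le_trans _ _ (\sum_(i < k) `|v| ^+ 2))//.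
  apply: ler_sum => i _; rewrite -expr2 -[leLHS]real_normK ?num_real//.
  by rewrite lerXn2r ?nnegrE.
rewrite sumr_const card_ord exprMn -[leLHS]mulr_natl ler_wpM2r ?sqr_ge0//.
by rewrite -natrX ler_nat; case: k => // n; rewrite -[leqLHS]expn1 leq_pexp2l.
Qed.

End euclidean.

(** * Differential calculus for the Euclidean and operator norms *)

Lemma near_norm_le (R : realType) (k : nat) (x : 'rV[R]_k) (eps : R) :
  0 < eps -> \forall y \near x, `|x - y| <= eps.
Proof.
move=> eps0; have : id @ nbhs x --> x by exact: cvg_id.
by move=> /cvgrPdist_le; apply.
Qed.

(** A remainder bounded by [C |h|^2] near zero is a little-o of [h]; stated on an
    abstract normed space, where the Landau notations elaborate. *)
Lemma quadratic_remainder_diff (R : realType) (V : normedModType R)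
    (f : V -> R) (z : V) (df : {linear V -> R}) (r C : R) :
  0 < r -> continuous df ->
  (forall h, `|h| <= r -> `|f (z + h) - f z - df h| <= C * `|h| ^+ 2) ->
  differentiable f z /\ 'd f z = df :> (V -> R).
Proof.
move=> r0 cdf Cf.
have rem : f \o shift z = cst (f z) + df +o_ 0 id.
  apply/eqaddoP => _/posnumP[eps]; near=> h.
  have hr : `|h| <= r by near: h; exact: nbhs0_le.
  rewrite !fctE /= [h + z]addrC opprD addrA.
  apply: (le_trans (Cf _ hr)).
  have c0 : 0 < `|C| + 1 by rewrite ltr_wpDl.
  rewrite expr2 mulrA ler_wpM2r// (@le_trans _ _ ((`|C| + 1) * `|h|))//.
    by rewrite ler_wpM2r// (le_trans (ler_norm C))// lerDl.
  rewrite mulrC -ler_pdivlMr//; near: h; apply: nbhs0_le.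
have dfE := diff_unique cdf rem.
by split => //; apply/diff_locallyP; rewrite dfE.
Unshelve. all: by end_near. Qed.

Section calculus.
Context (R : realType) (k : nat).
Implicit Types (f : 'rV[R]_k -> R) (x y z a b h v e : 'rV[R]_k) (K L C : R).

Lemma derive_grad f x v : differentiable f x -> 'D_v f x = dot (grad f x) v.
Proof.
move=> df; rewrite deriveE// {1}(row_sum_delta v) linear_sum.
by apply: eq_bigr => i _; rewrite linearZ /= mxE deriveE// mulrC.
Qed.

Lemma differentiable_coords (p : nat) (g : 'rV[R]_k -> 'rV[R]_p) x :
  (forall i, differentiable (fun y => g y 0 i) x) -> differentiable g x.
Proof.
move=> dg.
have -> : g = \sum_(i < p) (fun y => g y 0 i *: delta_mx 0 i).
  by apply/funext => y; rewrite fct_sumE -row_sum_delta.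
by apply: differentiable_sum => i; exact: differentiableZl.
Qed.

Lemma is_derive_line f a h (t : R) : differentiable f (a + t *: h) ->
  is_derive t 1 (fun s => f (a + s *: h)) (dot (grad f (a + t *: h)) h).
Proof.
move=> df.
have dl : is_diff t (fun s : R => a + s *: h) (fun s => s *: h).
  have -> : (fun s : R => a + s *: h) =
      (cst a : R -> 'rV[R]_k) + (( *:%R ^~ h) : R -> 'rV[R]_k).
    by apply/funext => s; rewrite fctE.
  have : is_diff t ((cst a : R -> 'rV[R]_k) + (( *:%R ^~ h) : R -> 'rV[R]_k))
      (0 + *:%R ^~ h) by exact: is_diffD.
  by rewrite add0r.
have dc : is_diff t (f \o (fun s : R => a + s *: h))
    ('d f (a + t *: h) \o (fun s => s *: h)).
  by apply: is_diff_comp; exact: differentiableP.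
split; first exact/derivable1_diffP.
rewrite deriveE; last exact: ex_diff.
by rewrite diff_val/= scale1r -derive_grad// deriveE.
Qed.

Lemma mean_value f a h : (forall x, differentiable f x) ->
  exists2 c : R, 0 <= c <= 1 & f (a + h) - f a = dot (grad f (a + c *: h)) h.
Proof.
move=> df.
have [||c] := @MVT_segment R (fun t => f (a + t *: h))
    (fun t => dot (grad f (a + t *: h)) h) 0 1 ler01.
- by move=> t _; exact: is_derive_line.
- apply: derivable_within_continuous => t _.
  by have := is_derive_line (df (a + t *: h)); case.
rewrite in_itv/= => c01; rewrite scale0r scale1r addr0 subr0 mulr1 => E.
by exists c.
Qed.

Lemma is_derive_quadratic (c1 c2 t : R) :
  is_derive t 1 (fun s : R => s * c1 + s ^+ 2 * c2) (c1 + 2 * t * c2).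
Proof.
have -> : (fun s : R => s * c1 + s ^+ 2 * c2) = horner (c1 *: 'X + c2 *: 'X^2).
  by apply/funext => s; rewrite hornerD !hornerZ hornerX hornerXn; ring.
have -> : c1 + 2 * t * c2 = (c1 *: 'X + c2 *: 'X^2)^`().[t].
  rewrite derivD !derivZ derivX derivXn hornerD !hornerZ hornerC hornerMn hornerX.
  by rewrite -mulr_natl; ring.
exact: is_derive_poly.
Qed.

(** The function [t |-> f (a + t h) - t <grad f a, h> - t^2 L/2 |h|^2] has
    nonpositive derivative on [[0, 1]]: its value at 1 is at most its value
    at 0. *)
Lemma taylor1_le f L a h : (forall x, differentiable f x) ->
  (forall x y, enorm (grad f x - grad f y) <= L * enorm (x - y)) ->
  f (a + h) - f a - dot (grad f a) h <= L / 2 * enorm h ^+ 2.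
Proof.
move=> df Lf.
pose c1 := dot (grad f a) h; pose c2 := L / 2 * enorm h ^+ 2.
pose phi := fun t : R => f (a + t *: h) - (t * c1 + t ^+ 2 * c2).
pose dphi := fun t : R => dot (grad f (a + t *: h)) h - (c1 + 2 * t * c2).
have phiE (t : R) : is_derive t 1 phi (dphi t).
  apply: is_deriveB; first exact: is_derive_line.
  exact: is_derive_quadratic.
have phi_cont : {within `[0, 1], continuous phi}.
  by apply: derivable_within_continuous => t _; case: (phiE t).
have [c] := @MVT_segment R phi dphi 0 1 ler01 (fun t _ => phiE t) phi_cont.
rewrite in_itv/= => /andP[c0 c1'].
rewrite /phi scale0r scale1r addr0 !mul0r expr0n/= mul0r addr0 !subr0 mulr1 expr1n !mul1r.
move=> E; have : dphi c <= 0.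
  have := le_trans (ler_norm _) (cauchy_schwarz (grad f (a + c *: h) - grad f a) h).
  have := Lf (a + c *: h) a.
  rewrite [a + _ - a]addrC addKr enormZ (ger0_norm c0) dotBl -/c1 /dphi => h1 h2.
  have : enorm (grad f (a + c *: h) - grad f a) * enorm h <=
    L * (c * enorm h) * enorm h by rewrite ler_wpM2r ?enorm_ge0.
  rewrite /c2; lra.
rewrite -/c1 -/c2; lra.
Qed.

Lemma gradN f x : differentiable f x -> grad (- f) x = - grad f x.
Proof.
by move=> df; apply/rowP => i; rewrite !mxE deriveN//; exact: diff_derivable.
Qed.

(** Applying the one-sided estimate to [- f] gives the other side. *)
Lemma taylor1 f L a h : classC1 L f ->
  `|f (a + h) - f a - dot (grad f a) h| <= L / 2 * enorm h ^+ 2.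
Proof.
move=> [df Lf]; rewrite ler_norml taylor1_le// andbT.
have : (- f) (a + h) - (- f) a - dot (grad (- f) a) h <= L / 2 * enorm h ^+ 2.
  apply: taylor1_le => [x|x y]; first exact: differentiableN.
  by rewrite !gradN// -opprD enormN.
rewrite !fctE gradN// -[- grad f a]scaleN1r dotZl; lra.
Qed.

(** A negative constant is excluded as soon as the space has two points. *)
Lemma lipschitz_const_ge0 L : (0 < k)%N ->
  (forall x y, 0 <= L * enorm (x - y)) -> 0 <= L.
Proof.
case: k => // n _ /(_ (delta_mx 0 ord0) 0); rewrite subr0.
have : 0 < enorm (delta_mx 0 ord0 : 'rV[R]_n.+1).
  rewrite (lt_le_trans ltr01)//.
  have := enorm_coord (delta_mx 0 ord0 : 'rV[R]_n.+1) ord0.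
  by rewrite mxE !eqxx normr1.
by move=> p; rewrite pmulr_lge0.
Qed.

Lemma classC0_ge0 L f : (0 < k)%N -> classC0 L f -> 0 <= L.
Proof.
by move=> k0 Lf; apply: lipschitz_const_ge0 => // x y; exact: le_trans (Lf x y).
Qed.

Lemma classC1_ge0 L f : (0 < k)%N -> classC1 L f -> 0 <= L.
Proof.
move=> k0 [_ Lf]; apply: lipschitz_const_ge0 => // x y.
exact: le_trans (enorm_ge0 _) (Lf x y).
Qed.

(** The weight [1 + |x| + |y|] covers the first derivatives of functions of
    class [C^2], which are Lipschitz only on bounded sets. *)
Lemma locally_lipschitz_continuous f K :
  (forall x y, `|f x - f y| <= K * (1 + enorm x + enorm y) * enorm (x - y)) ->
  continuous f.
Proof.
move=> Kf x; apply/(@cvgrPdist_le _ _ _ (nbhs x)) => /= eps eps0.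
pose c := `|K| * (2 + 2 * enorm x) * k%:R + 1.
have x0 := enorm_ge0 x.
have c0 : 0 < c by rewrite ltr_wpDl// !mulr_ge0//; lra.
near=> y.
have xyk := enorm_le_norm (x - y).
have xy1 : enorm (x - y) <= 1.
  apply: (le_trans xyk); rewrite (@le_trans _ _ ((k%:R + 1) * `|x - y|))//.
    by rewrite ler_wpM2r// lerDl.
  have k1 : 0 < k%:R + 1 :> R by rewrite ltr_wpDl.
  rewrite mulrC -ler_pdivlMr//; near: y; apply: near_norm_le.
have yx : enorm y <= enorm x + 1.
  have -> : y = x - (x - y) by rewrite opprB addrC subrK.
  by rewrite (le_trans (enormD _ _))// enormN lerD2l.
apply: (le_trans (Kf x y)); rewrite (@le_trans _ _ (c * `|x - y|))//.
  rewrite (@le_trans _ _ (`|K| * (2 + 2 * enorm x) * enorm (x - y)))//.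
    rewrite ler_wpM2r ?enorm_ge0//.
    rewrite (@le_trans _ _ (`|K| * (1 + enorm x + enorm y)))//.
      rewrite ler_wpM2r ?ler_norm//; have := enorm_ge0 y; lra.
    rewrite ler_wpM2l//; lra.
  rewrite (@le_trans _ _ (`|K| * (2 + 2 * enorm x) * (k%:R * `|x - y|)))//.
    by rewrite ler_wpM2l// mulr_ge0//; lra.
  by rewrite mulrA ler_wpM2r// lerDl.
rewrite mulrC -ler_pdivlMr//.
near: y; apply: near_norm_le; exact: divr_gt0.
Unshelve. all: by end_near. Qed.

Lemma classC0_continuous L f : classC0 L f -> continuous f.
Proof.
move=> Lf; apply: (@locally_lipschitz_continuous _ `|L|) => x y.
apply: (le_trans (Lf x y)); rewrite ler_wpM2r ?enorm_ge0//.
apply: (le_trans (ler_norm L)); rewrite ler_peMr//.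
have := enorm_ge0 x; have := enorm_ge0 y; lra.
Qed.

Lemma enorm_classC0 : classC0 1 (@enorm R k).
Proof.
move=> x y; rewrite mul1r.
have h u v : enorm u - enorm v <= enorm (u - v :> 'rV[R]_k).
  by rewrite lerBlDr -{1}(subrK v u) enormD.
by rewrite ler_norml h lerNl opprB -(enormN (x - y)) opprB h.
Qed.

(** The Euclidean form of [quadratic_remainder_diff]: [k + 1] and [k] compare the
    Euclidean norm with the sup norm that defines the topology. *)
Lemma quadratic_remainder_differentiable f g z C :
  (forall h, enorm h <= 1 ->
    `|f (z + h) - f z - dot g h| <= C * enorm h ^+ 2) ->
  differentiable f z /\ forall v, 'D_v f z = dot g v.
Proof.
move=> Cf.
have dlin : linear (dot g) by move=> a u v; rewrite dotDr dotZr.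
pose dL : {linear 'rV[R]_k -> R} :=
  HB.pack (dot g) (GRing.isLinear.Build _ _ _ _ _ dlin).
have cdL : continuous dL.
  apply: (@classC0_continuous (enorm g)) => x y.
  by rewrite -linearB /= cauchy_schwarz.
have k1 : 0 < k%:R + 1 :> R by rewrite ltr_wpDl.
have k1V : 0 < (k%:R + 1 : R)^-1 by rewrite invr_gt0.
have [h|df dfE] := @quadratic_remainder_diff _ _ f z dL (k%:R + 1)^-1
    (`|C| * k%:R ^+ 2) k1V cdL.
- rewrite -[_^-1]mul1r ler_pdivlMr// => hk1; have hk := enorm_le_norm h.
  have h1 : enorm h <= 1.
    apply: (le_trans hk); rewrite (le_trans _ hk1)// mulrC ler_wpM2l//.
    by rewrite lerDl.
  rewrite (le_trans (Cf _ h1))// (@le_trans _ _ (`|C| * enorm h ^+ 2))//.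
    by rewrite ler_wpM2r ?sqr_ge0// ler_norm.
  by rewrite -mulrA -exprMn ler_wpM2l// lerXn2r ?nnegrE ?enorm_ge0// mulr_ge0.
- by split => // v; rewrite deriveE// dfE.
Qed.

End calculus.

Section opnorm.
Context (R : realType) (k : nat).
Implicit Types (v e : 'rV[R]_k) (A B : 'M[R]_k).

Lemma mulmx_dot v A j : (v *m A) 0 j = dot v (col j A)^T.
Proof. by rewrite mxE; apply: eq_bigr => i _; rewrite !mxE. Qed.

(** Cauchy-Schwarz in each column bounds the set by the Frobenius norm, so the
    supremum in [opnorm] is a genuine least upper bound. *)
Lemma opnorm_has_sup A :
  has_sup [set enorm (v *m A) | v in [set v : 'rV[R]_k | enorm v <= 1]].
Proof.
split; first by exists (enorm (0 *m A)); exists 0 => //=; rewrite enorm0.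
exists (enorm (\row_j enorm (col j A)^T)) => _ [v /= v1 <-].
rewrite ler_wsqrtr// ler_sum// => j _.
rewrite mulmx_dot mxE -[leLHS]real_normK ?num_real// lerXn2r ?nnegrE ?enorm_ge0//.
by rewrite (le_trans (cauchy_schwarz _ _))// ler_piMl ?enorm_ge0.
Qed.

Lemma enorm_mulmx_le v A : enorm (v *m A) <= opnorm A * enorm v.
Proof.
have [/enorm_eq0 ->|v0] := eqVneq (enorm v) 0.
  by rewrite mul0mx enorm0 mulr0.
have vgt0 : 0 < enorm v by rewrite lt_neqAle eq_sym v0 enorm_ge0.
rewrite -ler_pdivrMr//.
apply: ub_le_sup; first by case: (opnorm_has_sup A).
exists ((enorm v)^-1 *: v) => /=.
  by rewrite enormZ gtr0_norm ?invr_gt0// mulVf.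
by rewrite -scalemxAl enormZ gtr0_norm ?invr_gt0// mulrC.
Qed.

Lemma opnorm_ge0 A : 0 <= opnorm A.
Proof.
apply: le_trans (enorm_ge0 (0 *m A)) _.
apply: ub_le_sup; first by case: (opnorm_has_sup A).
by exists 0 => //=; rewrite enorm0.
Qed.

Lemma opnorm_le (C : R) A : 0 <= C ->
  (forall v e, dot (v *m A) e <= C * enorm v * enorm e) -> opnorm A <= C.
Proof.
move=> C0 CA; apply: ge_sup; first by case: (opnorm_has_sup A).
move=> _ [v /= v1 <-]; apply: enorm_dual => // e.
by rewrite (le_trans (CA v e))// ler_wpM2r ?enorm_ge0// ler_piMr.
Qed.

End opnorm.

Section second_order.
Context (R : realType) (k : nat).
Implicit Types (f q : 'rV[R]_k -> R) (x y v e : 'rV[R]_k) (L : R).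

Lemma derive_gradE q e : (forall x, differentiable q x) ->
  'D_e q = \sum_(j < k) e 0 j *: (fun x => grad q x 0 j).
Proof.
move=> dq; apply/funext => x; rewrite derive_grad// fct_sumE.
by apply: eq_bigr => j _; rewrite mulrC.
Qed.

Lemma differentiable_grad_coord q x j : differentiable (grad q) x ->
  differentiable (fun y => grad q y 0 j) x.
Proof.
move=> dg; apply: (@differentiable_comp _ _ _ _ (grad q) (fun M => M 0 j)) => //.
exact: differentiable_coord.
Qed.

Lemma differentiable_derive q e x : (forall y, differentiable q y) ->
  differentiable (grad q) x -> differentiable ('D_e q) x.
Proof.
move=> dq dg; rewrite derive_gradE//; apply: differentiable_sum => j.
exact/differentiableZ/differentiable_grad_coord.
Qed.

Lemma derive2_hessian q v e x : (forall y, differentiable q y) ->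
  differentiable (grad q) x ->
  'D_v ('D_e q) x = dot (v *m hessian q x) e.
Proof.
move=> dq dg; rewrite /hessian -deriveEjacobian// derive_mx; last first.
  exact: diff_derivable.
have dj j : derivable (fun y => grad q y 0 j) x v.
  exact/diff_derivable/differentiable_grad_coord.
rewrite derive_gradE// derive_sum; last by move=> j; exact: derivableZ.
by apply: eq_bigr => j _; rewrite mxE deriveZ// mulrC.
Qed.

Lemma classC2_derive2 L q v e : classC2 L q ->
  classC0 (L * enorm v * enorm e) ('D_v ('D_e q)).
Proof.
move=> [dq dg Lq] x y; rewrite !derive2_hessian// -dotBl -mulmxBr.
apply: (le_trans (cauchy_schwarz _ _)).
rewrite mulrAC ler_wpM2r ?enorm_ge0//.
rewrite (le_trans (enorm_mulmx_le _ _))// mulrAC.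
by rewrite ler_wpM2r ?enorm_ge0.
Qed.

Lemma classC2_ge0 L q : (0 < k)%N -> classC2 L q -> 0 <= L.
Proof.
move=> k0 [_ _ Lq]; apply: (lipschitz_const_ge0 k0) => x y.
exact: le_trans (opnorm_ge0 _) (Lq x y).
Qed.

(** By duality: the pairing of the gradient of ['D_e q] with [v] is
    ['D_v ('D_e q)], which [classC2_derive2] controls. *)
Lemma classC2_derive L q e : (0 < k)%N -> classC2 L q -> classC1 (L * enorm e) ('D_e q).
Proof.
move=> k0 Cq; have [dq dg Lq] := Cq.
have dD x : differentiable ('D_e q) x by exact: differentiable_derive.
have L0 := classC2_ge0 k0 Cq.
split => // x y; apply: enorm_dual => [|v].
  by rewrite !mulr_ge0 ?enorm_ge0.
have -> : dot (grad ('D_e q) x - grad ('D_e q) y) v =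
    'D_v ('D_e q) x - 'D_v ('D_e q) y.
  by rewrite dotBl; congr (_ - _); exact/esym/derive_grad.
rewrite (le_trans (ler_norm _))//.
apply: (le_trans (classC2_derive2 v e Cq x y)).
by rewrite le_eqVlt; apply/orP; left; apply/eqP; ring.
Qed.

(** The Hessian grows at most linearly, hence the gradient is Lipschitz on
    bounded sets with a constant growing linearly with the set. *)
Lemma classC2_grad_growth L q : (0 < k)%N -> classC2 L q ->
  exists2 K : R, 0 <= K & forall x y,
    enorm (grad q x - grad q y) <= K * (1 + enorm x + enorm y) * enorm (x - y).
Proof.
move=> k0 Cq; have [dq dg Lq] := Cq.
have L0 := classC2_ge0 k0 Cq.
have H0 := opnorm_ge0 (hessian q 0).
exists (L + opnorm (hessian q 0)) => [|x y]; first exact: addr_ge0.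
apply: enorm_dual => [|e].
  by rewrite !mulr_ge0 ?enorm_ge0// ?addr_ge0 ?enorm_ge0.
rewrite dotBl -(derive_grad e (dq x)) -(derive_grad e (dq y)).
have [c /andP[c0 c1]] := @mean_value _ _ ('D_e q) y (x - y)
  (fun z => differentiable_derive e dq (dg z)).
rewrite subrKC => ->.
rewrite -derive_grad; last exact: differentiable_derive.
rewrite derive2_hessian// (le_trans (ler_norm _))//.
rewrite (le_trans (cauchy_schwarz _ _))// ler_wpM2r ?enorm_ge0//.
set w := x - y; set z := y + c *: w.
have zle : enorm z <= enorm x + enorm y.
  have -> : z = c *: x + (1 - c) *: y.
    by apply/rowP => i; rewrite !mxE; ring.
  rewrite (le_trans (enormD _ _))// !enormZ !ger0_norm ?subr_ge0//.
  by rewrite lerD// ler_piMl ?enorm_ge0// gerBl.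
rewrite -[hessian q z](subrK (hessian q 0)) mulmxDr (le_trans (enormD _ _))//.
apply: (le_trans (lerD (enorm_mulmx_le _ _) (enorm_mulmx_le _ _))).
rewrite -mulrDl ler_wpM2r ?enorm_ge0//.
have := Lq z 0; rewrite subr0 => /le_trans h.
have := h _ (ler_wpM2l L0 zle).
have := enorm_ge0 x; have := enorm_ge0 y.
move: H0; set o := opnorm (hessian q 0); set p := opnorm _.
move=> o0 y0 x0 pz; nra.
Qed.

End second_order.

Section derivative_classes.
Context (R : realType) (k : nat).
Implicit Types (f q : 'rV[R]_k -> R) (x y z e v : 'rV[R]_k) (L : R).

Lemma classC1_derive L f e : classC1 L f -> classC0 (L * enorm e) ('D_e f).
Proof.
move=> [df Lf] x y.
have -> : 'D_e f x - 'D_e f y = dot (grad f x - grad f y) e.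
  by rewrite dotBl; congr (_ - _); exact: derive_grad.
rewrite (le_trans (cauchy_schwarz _ _))// mulrAC.
by rewrite ler_wpM2r ?enorm_ge0.
Qed.

Lemma classC1_grad_growth L f : 0 <= L -> classC1 L f -> forall x y,
  enorm (grad f x - grad f y) <= L * (1 + enorm x + enorm y) * enorm (x - y).
Proof.
move=> L0 [df Lf] x y; apply: (le_trans (Lf x y)); rewrite ler_wpM2r ?enorm_ge0//.
rewrite ler_peMr//; have := enorm_ge0 x; have := enorm_ge0 y; lra.
Qed.

End derivative_classes.

(** * Measurability of continuous functions of a random vector *)

Section measurability.
Context d (T : measurableType d) (R : realType) (k : nat).

(** An open set is the union of the boxes with rational endpoints that it
    contains, a countable family; the preimage of a box is a finite intersection
    of preimages of intervals under the coordinates. *)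
Lemma measurable_open_preimage (W : T -> 'rV[R]_k) (U : set 'rV[R]_k) :
  (forall i, measurable_fun [set: T] (fun t => W t 0 i)) ->
  open U -> measurable (W @^-1` U).
Proof.
move=> mW oU.
pose box (c : 'rV[rat]_k * 'rV[rat]_k) : set 'rV[R]_k :=
  [set v | forall i, ratr (c.1 0 i) < v 0 i < ratr (c.2 0 i)].
have -> : W @^-1` U =
    \bigcup_c (if pselect (box c `<=` U) then W @^-1` (box c) else set0).
  apply/seteqP; split => [t /= Ut|t [c _]]; last by case: pselect => // cU; exact: cU.
  have /nbhs_ballP[e /= e0 eU] := oU _ Ut.
  have /boolp.choice[lo loP] (i : 'I_k) :
      exists r : rat, ratr r \in `]W t 0 i - e, W t 0 i[.
    by apply: rat_in_itvoo; rewrite ltrBlDr ltrDl.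
  have /boolp.choice[hi hiP] (i : 'I_k) :
      exists r : rat, ratr r \in `]W t 0 i, W t 0 i + e[.
    by apply: rat_in_itvoo; rewrite ltrDl.
  exists (\row_i lo i, \row_i hi i) => //.
  case: pselect => [_ i /=|[]].
    rewrite !mxE; have := loP i; have := hiP i.
    by rewrite !in_itv/= => /andP[-> _] /andP[_ ->].
  move=> v vbox; apply: eU; split => // i j.
  rewrite (ord1 i); have := vbox j; rewrite /= !mxE => /andP[h1 h2].
  have := loP j; have := hiP j; rewrite !in_itv/= => /andP[h3 h4] /andP[h5 h6].
  rewrite /ball/= ltr_distlC; apply/andP; split; lra.
apply: countable_bigcupT_measurable => [|c]; first exact: countableP.
case: pselect => cU; last exact: measurable0.
have -> : W @^-1` (box c) = \bigcap_(i in [set: 'I_k])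
    ((fun t => W t 0 i) @^-1` `]ratr (c.1 0 i), ratr (c.2 0 i)[).
  apply/seteqP; split => [t h i _|t h i] /=.
    by rewrite in_itv/=; exact: h.
  by have := h i Logic.I; rewrite /= in_itv.
apply: fin_bigcap_measurable => // i _.
by rewrite -[X in measurable X]setTI; apply: mW.
Qed.

Lemma measurable_continuous_row (W : T -> 'rV[R]_k) (f : 'rV[R]_k -> R) :
  (forall i, measurable_fun [set: T] (fun t => W t 0 i)) ->
  continuous f -> measurable_fun [set: T] (fun t => f (W t)).
Proof.
move=> mW /continuousP cf; apply: (measurability _ (RGenOpens.measurableE R)).
move=> _ [_ [a [b ->] <-]]; rewrite setTI.
exact: (@measurable_open_preimage W (f @^-1` `]a, b[) mW (cf _ (interval_open _ _))).
Qed.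

End measurability.

(** * Smoothing by an arbitrary random vector *)

Section expectation.
Context d (T : measurableType d) (R : realType) (P : probability T R).
Implicit Types (g : T -> R).

Local Notation integrable g := (P.-integrable [set: T] (EFin \o g)).

Lemma integrable_cst_fun (c : R) : integrable (fun=> c).
Proof. exact: finite_measure_integrable_cst. Qed.

Lemma expect_cst (c : R) : \int[P]_t c = c.
Proof.
transitivity (c * fine (P [set: T])); first exact: Rintegral_cst.
by rewrite probability_setT mulr1.
Qed.

Lemma integrable_sum_fun (p : nat) (g : 'I_p -> T -> R) :
  (forall i, integrable (g i)) -> integrable (fun t => \sum_(i < p) g i t).
Proof.
move=> ig; apply: (eq_integrable measurableT (fun t => \sum_(i < p) (g i t)%:E)%E) => //.
  by move=> t _; rewrite /= sumEFin.
by apply: (integrable_sum measurableT) => i _; exact: ig.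
Qed.

Lemma expect_sum (p : nat) (g : 'I_p -> T -> R) :
  (forall i, integrable (g i)) ->
  \int[P]_t (\sum_(i < p) g i t) = \sum_(i < p) \int[P]_t g i t.
Proof.
elim: p g => [|p ih] g ig.
  by rewrite big_ord0 -[RHS](expect_cst 0); apply: eq_Rintegral => t _; rewrite big_ord0.
rewrite big_ord_recl -ih// -RintegralD//; last exact: integrable_sum_fun.
by apply: eq_Rintegral => t _; rewrite big_ord_recl.
Qed.

Lemma integrableZ_fun (c : R) g : integrable g -> integrable (fun t => c * g t).
Proof. by move=> ig; apply: (integrableZl measurableT c ig). Qed.

Lemma integrableB_fun g1 g2 : integrable g1 -> integrable g2 ->
  integrable (fun t => g1 t - g2 t).
Proof. by move=> i1 i2; apply: (integrableB measurableT i1 i2). Qed.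

Lemma integrableD_fun g1 g2 : integrable g1 -> integrable g2 ->
  integrable (fun t => g1 t + g2 t).
Proof. by move=> i1 i2; apply: (integrableD measurableT i1 i2). Qed.

Lemma dominated_integrable g1 g2 : measurable_fun [set: T] g1 ->
  (forall t, `|g1 t| <= g2 t) -> integrable g2 -> integrable g1.
Proof.
move=> m1 g12; apply: le_integrable => //; first exact/measurable_EFinP.
by move=> t _; rewrite /= lee_fin (le_trans (g12 t))// ler_norm.
Qed.

Lemma expect_norm_le g1 g2 : integrable g1 -> integrable g2 ->
  (forall t, `|g1 t| <= g2 t) -> `|\int[P]_t g1 t| <= \int[P]_t g2 t.
Proof.
move=> i1 i2 g12; apply: (le_trans (le_normr_Rintegral _ _)) => //.
by apply: le_Rintegral => //; exact: integrable_norm.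
Qed.

End expectation.

Definition mollify d (T : measurableType d) (R : realType) (P : probability T R)
    (k : nat) (W : T -> 'rV[R]_k) (f : 'rV[R]_k -> R) (z : 'rV[R]_k) : R :=
  \int[P]_t f (z + W t).

Section mollify.
Context d (T : measurableType d) (R : realType) (P : probability T R).
Context (k : nat) (W : T -> 'rV[R]_k).
Hypothesis mW : forall i, measurable_fun [set: T] (fun t => W t 0 i).
Hypothesis iW4 : forall i, P.-integrable [set: T] (fun t => (W t 0 i ^+ 4)%:E).
Implicit Types (f : 'rV[R]_k -> R) (z h v : 'rV[R]_k) (C K L : R).

Local Notation integrable g := (P.-integrable [set: T] (EFin \o g)).
Local Notation sm := (mollify P W).

Lemma measurable_shift f z : continuous f ->
  measurable_fun [set: T] (fun t => f (z + W t)).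
Proof.
move=> cf; apply: (@measurable_continuous_row _ _ _ _ (fun t => z + W t)) => // i.
have -> : (fun t => (z + W t) 0 i) = (fun t => z 0 i + W t 0 i).
  by apply/funext => t; rewrite mxE.
by apply: measurable_funD => //; exact: measurable_cst.
Qed.

Let measurable_enorm : measurable_fun [set: T] (fun t => enorm (W t)).
Proof.
have -> : (fun t => enorm (W t)) = (fun t => enorm (0 + W t)).
  by apply/funext => t; rewrite add0r.
exact/measurable_shift/(classC0_continuous (@enorm_classC0 _ _)).
Qed.

(** Cauchy-Schwarz against the constant vector 1 bounds [(sum_i W_i^2)^2] by
    [k * sum_i W_i^4]. *)
Lemma integrable_enorm4 : integrable (fun t => enorm (W t) ^+ 4).
Proof.
apply: (@dominated_integrable _ _ _ _ _ (fun t => k%:R * \sum_(i < k) W t 0 i ^+ 4)).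
- exact: measurable_funX.
- move=> t; rewrite ger0_norm ?exprn_ge0 ?enorm_ge0//.
  rewrite (exprM _ 2 2) enorm_sqr.
  pose a : 'rV[R]_k := \row_i (W t 0 i ^+ 2).
  have -> : dot (W t) (W t) = dot a (const_mx 1).
    by apply: eq_bigr => i _; rewrite !mxE mulr1.
  rewrite -real_normK ?num_real//.
  rewrite (@le_trans _ _ ((enorm a * enorm (const_mx 1 : 'rV[R]_k)) ^+ 2))//.
    by rewrite lerXn2r ?nnegrE ?mulr_ge0 ?enorm_ge0// cauchy_schwarz.
  rewrite exprMn !enorm_sqr mulrC ler_pM//.
  + by rewrite -enorm_sqr sqr_ge0.
  + by rewrite -enorm_sqr sqr_ge0.
  + by rewrite /dot (eq_bigr (fun=> 1)) ?sumr_const ?card_ord// => i _; rewrite !mxE mulr1.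
  + by apply: ler_sum => i _; rewrite !mxE -expr2 -exprM.
- apply: integrableZ_fun; apply: integrable_sum_fun => i; exact: iW4.
Qed.

(** Dominates the integrands of this section: quartic growth covers
    functions of class [C^2], which grow at most cubically. *)
Lemma integrable_weight : integrable (fun t => (1 + enorm (W t)) ^+ 4).
Proof.
apply: (@dominated_integrable _ _ _ _ _ (fun t => 8 * (1 + enorm (W t) ^+ 4))).
- by apply: measurable_funX; apply: measurable_funD => //; exact: measurable_cst.
- move=> t; have := enorm_ge0 (W t); set x := enorm _ => x0.
  rewrite ger0_norm ?exprn_ge0 ?addr_ge0//.
  (* 8 (1 + x^4) - (1 + x)^4 = (1 - x)^2 (7 x^2 + 10 x + 7) *)
  rewrite -subr_ge0 (_ : _ - _ = (1 - x) ^+ 2 * (7 * x ^+ 2 + 10 * x + 7)); last by ring.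
  by rewrite mulr_ge0 ?sqr_ge0// !addr_ge0 ?mulr_ge0 ?sqr_ge0.
- apply: integrableZ_fun; apply: integrableD_fun; first exact: integrable_cst_fun.
  exact: integrable_enorm4.
Qed.

Lemma integrable_of_weight C (g : T -> R) : measurable_fun [set: T] g ->
  (forall t, `|g t| <= C * (1 + enorm (W t)) ^+ 4) -> integrable g.
Proof.
move=> mg Cg; apply: dominated_integrable Cg _ => //.
exact/integrableZ_fun/integrable_weight.
Qed.

Lemma weight_le z w : 1 + enorm (z + w) <= (1 + enorm z) * (1 + enorm w).
Proof.
have := enormD z w; have := mulr_ge0 (enorm_ge0 z) (enorm_ge0 w); lra.
Qed.

Lemma integrable_shift f C z : continuous f ->
  (forall x, `|f x| <= C * (1 + enorm x) ^+ 4) ->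
  integrable (fun t => f (z + W t)).
Proof.
move=> cf Cf.
apply: (@integrable_of_weight (`|C| * (1 + enorm z) ^+ 4)) => [|t].
  exact: measurable_shift.
apply: (le_trans (Cf _)).
rewrite (@le_trans _ _ (`|C| * (1 + enorm (z + W t)) ^+ 4))//.
  by rewrite ler_wpM2r ?ler_norm// exprn_ge0// addr_ge0 ?enorm_ge0.
rewrite -mulrA -exprMn ler_wpM2l// lerXn2r ?nnegrE ?weight_le//.
  by rewrite addr_ge0 ?enorm_ge0.
by rewrite mulr_ge0// addr_ge0 ?enorm_ge0.
Qed.

Lemma integrable_coord i : integrable (fun t => W t 0 i).
Proof.
apply: (@integrable_of_weight 1) => // t; rewrite mul1r.
apply: (le_trans (enorm_coord _ _)); have := enorm_ge0 (W t).
set x := enorm _ => x0.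
rewrite (@le_trans _ _ (1 + x))//; first by rewrite lerDr.
by rewrite -[leLHS]expr1 ler_weXn2l// lerDl.
Qed.

Lemma integrable_enorm2 : integrable (fun t => enorm (W t) ^+ 2).
Proof.
apply: (@integrable_of_weight 1) => [|t].
  exact: measurable_funX.
have := enorm_ge0 (W t); set x := enorm _ => x0.
rewrite mul1r ger0_norm ?sqr_ge0// (@le_trans _ _ ((1 + x) ^+ 2))//.
  by rewrite lerXn2r ?nnegrE ?addr_ge0// lerDr.
by rewrite ler_weXn2l// lerDl.
Qed.

Section values.
Variable s : R.
Hypothesis s0 : 0 < s.
Hypothesis W2 : \int[P]_t (enorm (W t) ^+ 2) <= s ^+ 2.

Lemma classC0_growth L f x : 0 <= L -> classC0 L f ->
  `|f x| <= (`|f 0| + L) * (1 + enorm x) ^+ 4.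
Proof.
move=> L0 /(_ x 0); rewrite subr0 => h; have x0 := enorm_ge0 x.
have p1 : 1 + enorm x <= (1 + enorm x) ^+ 4.
  by rewrite -[leLHS]expr1 ler_weXn2l// lerDl.
rewrite (@le_trans _ _ ((`|f 0| + L) * (1 + enorm x)))//; last first.
  by rewrite ler_wpM2l// addr_ge0.
have := ler_normD (f x - f 0) (f 0); rewrite subrK => h2.
have := mulr_ge0 (normr_ge0 (f 0)) x0; lra.
Qed.

(** By the inequality of arithmetic and geometric means
    [|W| <= s / 2 + |W|^2 / (2 s)], whose right-hand side has mean at most [s]. *)
Lemma mollify_classC0 L f z : 0 <= L -> classC0 L f ->
  integrable (fun t => f (z + W t)) /\ `|sm f z - f z| <= L * s.
Proof.
move=> L0 Lf.
have iS : integrable (fun t => f (z + W t)).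
  apply: integrable_shift (fun x => classC0_growth x L0 Lf).
  exact: classC0_continuous Lf.
split => //.
rewrite -(expect_cst P (f z)) /mollify -RintegralB//; last exact: integrable_cst_fun.
pose g t := L / (2 * s) * (s ^+ 2 + enorm (W t) ^+ 2).
have ig : integrable g.
  apply: integrableZ_fun; apply: integrableD_fun; first exact: integrable_cst_fun.
  exact: integrable_enorm2.
apply: (@le_trans _ _ (\int[P]_t g t)).
  apply: expect_norm_le => //.
    by apply: integrableB_fun => //; exact: integrable_cst_fun.
  move=> t; apply: (le_trans (Lf _ _)).
  rewrite [z + _ - z]addrC addKr /g -mulrA ler_wpM2l//.
  rewrite ler_pdivlMl ?mulr_gt0//.
  have := sqr_ge0 (s - enorm (W t)); rewrite sqrrB; lra.
rewrite RintegralZl//; last first.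
  apply: integrableD_fun; first exact: integrable_cst_fun.
  exact: integrable_enorm2.
rewrite RintegralD//; [|exact: integrable_cst_fun|exact: integrable_enorm2].
rewrite expect_cst (@le_trans _ _ (L / (2 * s) * (s ^+ 2 + s ^+ 2)))//.
  by rewrite ler_wpM2l ?lerD2l// divr_ge0// mulr_ge0// ltW.
rewrite le_eqVlt; apply/orP; left; apply/eqP; field.
by rewrite gt_eqF.
Qed.

Hypothesis W1 : forall i, \int[P]_t (W t 0 i) = 0.

Lemma integrable_dot v : integrable (fun t => dot v (W t)).
Proof.
by apply: integrable_sum_fun => i; apply: integrableZ_fun; exact: integrable_coord.
Qed.

Lemma expect_dot v : \int[P]_t (dot v (W t)) = 0.
Proof.
rewrite expect_sum => [|i]; last by apply: integrableZ_fun; exact: integrable_coord.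
by rewrite big1// => i _; rewrite RintegralZl ?W1 ?mulr0//; exact: integrable_coord.
Qed.

(** The linear term of the Taylor expansion of [f] at [z] has mean zero. *)
Lemma mollify_classC1 L f z : 0 <= L -> classC1 L f ->
  integrable (fun t => f (z + W t)) ->
  `|sm f z - f z| <= L / 2 * s ^+ 2.
Proof.
move=> L0 Lf iS.
have iC := @integrable_cst_fun _ _ _ P (f z).
have iB := integrableB_fun iS iC.
have iD := integrable_dot (grad f z).
have -> : sm f z - f z = \int[P]_t (f (z + W t) - f z - dot (grad f z) (W t)).
  by rewrite !RintegralB// expect_dot subr0 expect_cst.
apply: (@le_trans _ _ (\int[P]_t (L / 2 * enorm (W t) ^+ 2))).
  apply: expect_norm_le => [||t].
  - exact: integrableB_fun.
  - apply: integrableZ_fun; exact: integrable_enorm2.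
  - exact: taylor1.
rewrite RintegralZl//; last exact: integrable_enorm2.
by rewrite ler_wpM2l// divr_ge0.
Qed.

End values.

Section derivatives.
Variables (f : 'rV[R]_k -> R) (K : R).
Hypothesis df : forall x, differentiable f x.
Hypothesis K0 : 0 <= K.
Hypothesis Kf : forall x y,
  enorm (grad f x - grad f y) <= K * (1 + enorm x + enorm y) * enorm (x - y).

Let A := enorm (grad f 0) + K.

Let A0 : 0 <= A. Proof. by rewrite addr_ge0 ?enorm_ge0. Qed.

Lemma grad_growth x : enorm (grad f x) <= A * (1 + enorm x) ^+ 2.
Proof.
have x0 := enorm_ge0 x; have g0 := enorm_ge0 (grad f 0).
have := Kf x 0; rewrite subr0 enorm0 addr0 => h.
have := enormD (grad f x - grad f 0) (grad f 0); rewrite subrK => h2.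
have := mulr_ge0 K0 (addr_ge0 ler01 x0).
have := mulr_ge0 g0 (mulr_ge0 x0 (addr_ge0 (ler0n R 2) x0)).
rewrite /A; set p := enorm (grad f x) in h h2 *; set e := enorm x in h x0 *; nra.
Qed.

Lemma derive_growth v x : `|'D_v f x| <= A * enorm v * (1 + enorm x) ^+ 4.
Proof.
have x0 := enorm_ge0 x.
rewrite derive_grad// (le_trans (cauchy_schwarz _ _))// mulrAC.
rewrite ler_wpM2r ?enorm_ge0// (le_trans (grad_growth x))// ler_wpM2l//.
by rewrite ler_weXn2l// lerDl.
Qed.

Lemma fun_growth x : `|f x| <= (`|f 0| + A) * (1 + enorm x) ^+ 4.
Proof.
have x0 := enorm_ge0 x.
have [c /andP[c0 c1]] := mean_value 0 x df; rewrite !add0r => E.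
have cx : enorm (c *: x) <= enorm x.
  by rewrite enormZ ger0_norm// ler_piMl.
have p1 : 1 <= (1 + enorm x) ^+ 4 by rewrite exprn_ege1// lerDl.
have h : `|f x - f 0| <= A * (1 + enorm x) ^+ 4.
  rewrite E (le_trans (cauchy_schwarz _ _))//.
  rewrite (@le_trans _ _ (A * (1 + enorm x) ^+ 2 * (1 + enorm x) ^+ 2))//; last first.
    by rewrite -mulrA -exprD.
  rewrite ler_pM ?enorm_ge0//.
    rewrite (le_trans (grad_growth _))// ler_wpM2l// lerXn2r ?nnegrE ?addr_ge0 ?enorm_ge0//.
    by rewrite lerD2l.
  rewrite (@le_trans _ _ (1 + enorm x))//; first by rewrite lerDr.
  by rewrite -[leLHS]expr1 ler_weXn2l// lerDl.
have := ler_normD (f x - f 0) (f 0); rewrite subrK => h2.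
have := mulr_ge0 (normr_ge0 (f 0)) (_ : 0 <= (1 + enorm x) ^+ 4 - 1).
rewrite subr_ge0 => /(_ p1); lra.
Qed.

Lemma derive_continuous v : continuous ('D_v f).
Proof.
apply: (@locally_lipschitz_continuous _ _ _ (K * enorm v)) => x y.
have -> : 'D_v f x - 'D_v f y = dot (grad f x - grad f y) v.
  by rewrite dotBl; congr (_ - _); exact: derive_grad.
rewrite (le_trans (cauchy_schwarz _ _))//.
rewrite (le_trans (ler_wpM2r (enorm_ge0 v) (Kf x y)))//.
by rewrite le_eqVlt; apply/orP; left; apply/eqP; ring.
Qed.

Lemma integrable_shift_f z : integrable (fun t => f (z + W t)).
Proof.
apply: integrable_shift fun_growth => x; exact: differentiable_continuous.
Qed.

Lemma integrable_shift_derive v z : integrable (fun t => 'D_v f (z + W t)).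
Proof. by apply: integrable_shift (derive_growth v); exact: derive_continuous. Qed.

Lemma mollify_derive_dot z v :
  sm ('D_v f) z = dot (\row_i sm ('D_(delta_mx 0 i) f) z) v.
Proof.
have iD i : integrable (fun t => v 0 i * 'D_(delta_mx 0 i) f (z + W t)).
  by apply: integrableZ_fun; exact: integrable_shift_derive.
transitivity (\sum_(i < k) \int[P]_t (v 0 i * 'D_(delta_mx 0 i) f (z + W t))).
  rewrite -expect_sum//; apply: eq_Rintegral => t _.
  by rewrite derive_grad//; apply: eq_bigr => i _; rewrite mxE mulrC.
apply: eq_bigr => i _; rewrite RintegralZl//; last exact: integrable_shift_derive.
by rewrite !mxE mulrC.
Qed.

(** By the mean value theorem the remainder is the increment of the gradient
    along a part of the segment, paired with [h]. *)
Lemma remainder_le x h : enorm h <= 1 ->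
  `|f (x + h) - f x - 'D_h f x| <= 2 * K * (1 + enorm x) * enorm h ^+ 2.
Proof.
move=> h1; have x0 := enorm_ge0 x; have h0 := enorm_ge0 h.
have [c /andP[c0 c1] ->] := mean_value x h df.
rewrite derive_grad// -dotBl (le_trans (cauchy_schwarz _ _))//.
rewrite expr2 [leRHS]mulrA ler_wpM2r//.
apply: (le_trans (Kf _ _)).
rewrite [x + _ - x]addrC addKr.
have ch : enorm (c *: h) <= enorm h by rewrite enormZ ger0_norm// ler_piMl.
have xch := enormD x (c *: h).
rewrite ler_pM ?enorm_ge0//.
  by rewrite mulr_ge0// !addr_ge0 ?enorm_ge0.
rewrite [2 * K]mulrC -mulrA ler_wpM2l//; lra.
Qed.

(** The first-order remainder of [f] at [z + W] is at most [|h|^2] times an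
    integrable function; its mean is the remainder of the mollification. *)
Lemma mollify_differentiable z :
  differentiable (sm f) z /\ forall v, 'D_v (sm f) z = sm ('D_v f) z.
Proof.
set g := \row_i sm ('D_(delta_mx 0 i) f) z.
pose C := 2 * K * (1 + enorm z) * \int[P]_t ((1 + enorm (W t)) ^+ 4).
have [h h1|? E] := @quadratic_remainder_differentiable _ _ (sm f) g z C; last first.
  by split => // v; rewrite E mollify_derive_dot.
rewrite -mollify_derive_dot.
have i1 := integrable_shift_f (z + h).
have i2 := integrable_shift_f z.
have i3 := integrable_shift_derive h z.
have -> : sm f (z + h) - sm f z - sm ('D_h f) z =
    \int[P]_t (f (z + h + W t) - f (z + W t) - 'D_h f (z + W t)).
  by rewrite !RintegralB//; exact: integrableB_fun.
rewrite /C mulrAC -RintegralZl//; last exact: integrable_weight.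
apply: expect_norm_le => [||t].
- by apply: integrableB_fun => //; exact: integrableB_fun.
- by apply: integrableZ_fun; exact: integrable_weight.
rewrite [z + h + _]addrAC (le_trans (remainder_le _ h1))//.
have z0 := enorm_ge0 z; have w0 := enorm_ge0 (W t).
rewrite [leRHS](_ : _ =
  2 * K * ((1 + enorm z) * (1 + enorm (W t)) ^+ 4) * enorm h ^+ 2); last by ring.
rewrite ler_wpM2r ?sqr_ge0// ler_wpM2l ?mulr_ge0//.
rewrite (le_trans (weight_le _ _))// ler_wpM2l ?addr_ge0//.
by rewrite -[leLHS]expr1 ler_weXn2l// lerDl.
Qed.

End derivatives.

End mollify.

(** * Moments of the standard normal law *)

Section normal_moments.
Context (R : realType).
Local Notation mR := (measurableTypeR R).
Local Notation mu := (@lebesgue_measure R).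
Local Notation N := (normal_prob (0 : R) 1).

Let measurable_pow n : measurable_fun [set: mR] (fun x : mR => x ^+ n).
Proof. exact: exprn_measurable. Qed.

Let measurable_mul_sqr (c : R) : measurable_fun [set: mR] (fun x : mR => c * x ^+ 2).
Proof. by apply: measurable_funM => //; exact: measurable_cst. Qed.

Let measurable_exp_sqr (c : R) :
  measurable_fun [set: mR] (fun x : mR => expR (c * x ^+ 2)).
Proof. exact: measurableT_comp (measurable_mul_sqr c). Qed.

(** The explicit density and the Radon-Nikodym derivative represent the
    normal law, hence they agree almost everywhere. *)
Lemma ge0_integral_normal_prob (m s : R) (f : mR -> \bar R) :
  measurable_fun [set: mR] f -> (forall x, (0 <= f x)%E) ->
  (\int[normal_prob m s]_x f x = \int[mu]_x (f x * (normal_pdf m s x)%:E))%E.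
Proof.
move=> mf f0.
have dom := normal_prob_dominates m s.
rewrite -(Radon_Nikodym_SigmaFinite.change_of_variables dom)//.
apply: ae_eq_integral => //.
- apply: emeasurable_funM => //.
  exact: measurable_int (Radon_Nikodym_SigmaFinite.f_integrable dom).
- apply: emeasurable_funM => //; apply/measurable_EFinP.
  exact: measurable_normal_pdf.
- apply: ae_eqe_mul2l; apply: integral_ae_eq => //.
  + exact: Radon_Nikodym_SigmaFinite.f_integrable.
  + by apply/measurable_EFinP; exact: measurable_normal_pdf.
  + by move=> A _ mA; rewrite -Radon_Nikodym_SigmaFinite.f_integral.
Qed.

(** With [a = (1 - 1/s^2)/2], the weight [expR (a x^2)] turns the density of
    [N(0, 1)] into [s] times that of [N(0, s^2)]. *)
Lemma normal_exp_square_moment (s : R) : 0 < s ->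
  (\int[N]_x (expR ((1 - (s ^+ 2)^-1) / 2 * x ^+ 2))%:E = s%:E)%E.
Proof.
move=> s0; rewrite ge0_integral_normal_prob//; last first.
  exact/measurable_EFinP.
transitivity (\int[mu]_x (s%:E * (normal_pdf 0 s x)%:E))%E; last first.
  rewrite ge0_integralZl ?integral_normal_pdf ?mule1//.
  - by apply/measurable_EFinP; exact: measurable_normal_pdf.
  - by move=> x _; rewrite lee_fin normal_pdf_ge0.
  - by rewrite lee_fin ltW.
apply: eq_integral => x _; rewrite -!EFinM; congr EFin.
rewrite !normal_pdfE ?oner_eq0 ?gt_eqF// /normal_peak /normal_fun subr0.
rewrite expr1n mul1r -mulrnAr sqrtrM ?sqr_ge0// sqrtr_sqr gtr0_norm//.
rewrite (invfM s (Num.sqrt _)) -[in RHS]mulrA mulVKf ?gt_eqF// mulrCA -expRD.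
congr (_ * expR _); rewrite -mulr_natl; field.
by rewrite gt_eqF.
Qed.

(** With [a = (1 - 1/s^2)/2], the inequality [1 + a x^2 <= expR (a x^2)] and
    [normal_exp_square_moment] give [E X^2 <= (s - 1)/a = 2 s^2/(s + 1)] for
    every [s > 1]; let [s] tend to 1. *)
Lemma normal_square_moment_le : (\int[N]_x (x ^+ 2)%:E <= 1)%E.
Proof.
have h (s : R) : 1 < s -> (\int[N]_x (x ^+ 2)%:E <= (2 * s ^+ 2 / (s + 1))%:E)%E.
  move=> s1; have s0 : 0 < s by lra.
  pose a := (1 - (s ^+ 2)^-1) / 2.
  have a0 : 0 < a.
    rewrite divr_gt0// subr_gt0 invf_lt1 ?exprn_gt0//.
    by rewrite expr_gt1// ltW.
  have E : ((1 + a%:E * \int[N]_x (x ^+ 2)%:E) <= s%:E)%E.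
    rewrite -(normal_exp_square_moment s0) -ge0_integralZl//; last 3 first.
    - exact/measurable_EFinP.
    - by move=> x _; rewrite lee_fin sqr_ge0.
    - by rewrite lee_fin ltW.
    have -> : 1%E = (\int[N]_x 1)%E.
      rewrite integral_cst// mul1e; exact: (esym (@probability_setT _ _ _ (N : probability mR R))).
    rewrite -ge0_integralD//; last 2 first.
    - by move=> x _; rewrite -EFinM lee_fin mulr_ge0 ?sqr_ge0// ltW.
    - exact/measurable_EFinP.
    apply: ge0_le_integral => //.
    - by move=> x _; rewrite -EFinM -EFinD lee_fin addr_ge0// mulr_ge0 ?sqr_ge0// ltW.
    - by apply/measurable_EFinP/measurable_funD.
    - exact/measurable_EFinP.
    - by move=> x _; rewrite -EFinM -EFinD lee_fin expR_ge1Dx.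
  move: E; case: (integral _ _ _) => [r| |]//=.
  - rewrite -EFinM -EFinD !lee_fin => E.
    have : a * r <= s - 1 by lra.
    rewrite mulrC -ler_pdivlMr// => /le_trans; apply.
    rewrite le_eqVlt; apply/orP; left; apply/eqP; rewrite /a; field.
    by apply/and3P; split; rewrite gt_eqF//; nra.
  - by rewrite gt0_muley// ?lte_fin// addey.
  - by rewrite leNye.
have : (\int[N]_x (x ^+ 2)%:E < +oo)%E.
  by apply: le_lt_trans (h 2 _) _; rewrite ?ltry// ltr1n.
have : (0 <= \int[N]_x (x ^+ 2)%:E)%E.
  by apply: integral_ge0 => x _; rewrite lee_fin sqr_ge0.
case: (integral _ _ _) h => [r| |]// h _ _; rewrite lee_fin.
(* at s = 1 + e/2 the bound 2 s^2 / (s + 1) is at most 1 + e *)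
apply/ler_addgt0Pr => e e0; have := h (1 + e / 2) _; rewrite lee_fin ltrDl divr_gt0// => /(_ isT).
move/le_trans; apply; rewrite ler_pdivrMr; last lra.
nra.
Qed.

(** At [s = 2] the exponential weight is [expR (3/8 x^2)], which dominates
    [x^4] up to a constant. *)
Lemma normal_fourth_moment_lty : (\int[N]_x (x ^+ 4)%:E < +oo)%E.
Proof.
have s0 : (0 : R) < 2 by [].
apply: (@le_lt_trans _ _ (64 * 2)%:E); last exact: ltry.
have -> : (64 * 2 : R)%:E =
    (\int[N]_x (64%:E * (expR ((1 - (2 ^+ 2)^-1) / 2 * x ^+ 2))%:E))%E.
  rewrite ge0_integralZl ?normal_exp_square_moment//.
  exact/measurable_EFinP.
apply: ge0_le_integral => //.
- by move=> x _; rewrite lee_fin (exprM _ 2 2) sqr_ge0.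
- exact/measurable_EFinP.
- exact/measurable_EFinP/measurable_funM.
move=> x _; rewrite -EFinM lee_fin.
set a : R := (1 - _) / 2.
have aE : a = 3 / 8 by rewrite /a; field.
have := @expR_ge1Dxn R (a * x ^+ 2) 1; rewrite mulr_ge0 ?sqr_ge0 ?aE// => /(_ isT).
rewrite exprMn -exprM/= => h.
have -> : x ^+ 4 = 64 / 9 * ((3 / 8) ^+ 2 * x ^+ 4) :> R by field.
have : 0 <= x ^+ 4 by rewrite (exprM _ 2 2) sqr_ge0.
move: h; rewrite (_ : 2`! = 2%N)//.
set y := x ^+ 4; set e := expR _ => h y0.
lra.
Qed.

Lemma normal_probN (A : set mR) : measurable A ->
  pushforward N (-%R : mR -> mR) A = N A.
Proof.
move=> mA; rewrite /pushforward /normal_prob.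
rewrite [RHS](_ : _ = \int[pushforward mu (-%R : mR -> mR)]_(x in A)
    (normal_pdf 0 1 x)%:E)%E; last first.
  by apply: eq_measure_integral => //= B mB _; exact/esym/lebesgue_measureN.
rewrite ge0_integral_pushforward//.
- apply: eq_integral => x _; rewrite /= !normal_pdfE ?oner_eq0//.
  by rewrite /normal_fun !subr0 sqrrN.
- by apply/measurable_EFinP/measurable_funTS; exact: measurable_normal_pdf.
- by move=> x _; rewrite lee_fin normal_pdf_ge0.
Qed.

(** By symmetry the mean equals its opposite. *)
Lemma normal_mean : N.-integrable [set: mR] (fun x => x%:E) ->
  (\int[N]_x x%:E = 0)%E.
Proof.
move=> iN.
have E : (\int[N]_x x%:E = - \int[N]_x x%:E)%E.
  rewrite -[in RHS]integralN; last exact: integrable_add_def.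
  transitivity (\int[pushforward N (-%R : mR -> mR)]_x x%:E)%E.
    by apply: eq_measure_integral => A mA _; exact/esym/normal_probN.
  rewrite integral_pushforward//.
  have -> : (EFin : mR -> \bar R) \o (-%R : mR -> mR) = (-%E \o EFin : mR -> \bar R) by [].
  exact: integrableN.
have : (\int[N]_x x%:E \is a fin_num)%E by exact: integrable_fin_num.
move: E; case: (integral _ _ _) => // r [] E _; congr EFin; lra.
Qed.

End normal_moments.

(** * Gaussian coordinates *)

Section standard_normal_variable.
Context d (T : measurableType d) (R : realType) (P : probability T R).
Local Notation mR := (measurableTypeR R).
Context (X : T -> mR) (mX : measurable_fun [set: T] X).
Hypothesis lawX : forall A, measurable A -> P (X @^-1` A) = normal_prob (0 : R) 1 A.

Lemma ge0_integral_law (f : mR -> \bar R) :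
  measurable_fun [set: mR] f -> (forall x, (0 <= f x)%E) ->
  (\int[P]_t f (X t) = \int[normal_prob (0 : R) 1]_x f x)%E.
Proof.
move=> mf f0; transitivity (\int[pushforward P X]_x f x)%E.
  by rewrite ge0_integral_pushforward.
by apply: eq_measure_integral => A mA _; exact: lawX.
Qed.

Lemma integrable_normal4 : P.-integrable [set: T] (fun t => (X t ^+ 4)%:E).
Proof.
apply/integrableP; split.
  exact/measurable_EFinP/measurable_funX.
under eq_integral do rewrite gee0_abs ?lee_fin ?(exprM _ 2 2) ?sqr_ge0//.
rewrite (ge0_integral_law (f := fun x => ((x ^+ 2) ^+ 2)%:E)).
- under eq_integral do rewrite -exprM.
  exact: normal_fourth_moment_lty.
- by apply/measurable_EFinP; do 2 apply: measurable_funX.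
- by move=> x; rewrite lee_fin sqr_ge0.
Qed.

Lemma integrable_normal2 : P.-integrable [set: T] (fun t => (X t ^+ 2)%:E).
Proof.
apply: (@dominated_integrable _ _ _ _ (fun t => X t ^+ 2) (fun t => 1 + X t ^+ 4)).
- exact: measurable_funX.
- move=> t; rewrite ger0_norm ?sqr_ge0// (exprM _ 2 2).
  have := sqr_ge0 (X t ^+ 2 - 1); have := sqr_ge0 (X t).
  by set y := X t ^+ 2; rewrite sqrrB; lra.
by apply: integrableD_fun; [exact: integrable_cst_fun|exact: integrable_normal4].
Qed.

Lemma expect_normal2 : \int[P]_t (X t ^+ 2) <= 1.
Proof.
rewrite /Rintegral (ge0_integral_law (f := fun x => (x ^+ 2)%:E)).
- have := @normal_square_moment_le R.
  have : (0 <= \int[normal_prob (0 : R) 1]_x (x ^+ 2)%:E)%E.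
    by apply: integral_ge0 => x _; rewrite lee_fin sqr_ge0.
  by case: (integral _ _ _) => // r _; rewrite lee_fin.
- exact/measurable_EFinP/measurable_funX.
- by move=> x; rewrite lee_fin sqr_ge0.
Qed.

Lemma integrable_normal : P.-integrable [set: T] (fun t => (X t)%:E).
Proof.
apply: (@dominated_integrable _ _ _ _ X (fun t => 1 + X t ^+ 4)) => // [t|].
  have [x1|x1] := lerP `|X t| 1.
    by rewrite (le_trans x1)// lerDl (exprM _ 2 2) sqr_ge0.
  rewrite (@le_trans _ _ (`|X t| ^+ 4))//.
    by rewrite -[leLHS]expr1 ler_weXn2l// ltW.
  by rewrite (exprM _ 2 2) real_normK ?num_real// -exprM lerDr.
by apply: integrableD_fun; [exact: integrable_cst_fun|exact: integrable_normal4].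
Qed.

Lemma expect_normal : \int[P]_t X t = 0.
Proof.
have law : (\int[P]_t (X t)%:E = \int[normal_prob (0 : R) 1]_x x%:E)%E.
  transitivity (\int[pushforward P X]_x x%:E)%E.
    by rewrite integral_pushforward//; exact: integrable_normal.
  by apply: eq_measure_integral => A mA _; exact: lawX.
rewrite /Rintegral law normal_mean//.
apply/integrableP; split; first exact/measurable_EFinP.
rewrite -(ge0_integral_law (f := fun x => `|x%:E|%E))//.
  by have /integrableP[] := integrable_normal.
exact/measurableT_comp/measurable_EFinP.
Qed.

End standard_normal_variable.

Section gaussian_marginals.
Context (R : realType).
Local Notation mR := (measurableTypeR R).

Lemma measurable_tnth_preimage n (i : 'I_n) (A : set mR) : measurable A ->
  measurable ((fun t : n.-tuple mR => tnth t i) @^-1` A).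
Proof.
by move=> mA; rewrite -[X in measurable X]setTI; exact: measurable_tnth.
Qed.

(** The product of probabilities gives mass 1 to the coordinates left free. *)
Lemma std_gaussian_marginal n (i : 'I_n) (A : set mR) : measurable A ->
  std_gaussian R n ((fun t => tnth t i) @^-1` A) = normal_prob (0 : R) 1 A.
Proof.
move=> mA; elim: n i => [[]//|n ih] i.
rewrite -[LHS]/((normal_prob 0 1 \x std_gaussian R n)%E
  (@tcons R n @^-1` ((fun t => tnth t i) @^-1` A))).
have N1 : normal_prob (0 : R) 1 [set: mR] = 1%E := probability_setT _.
have [j ->|->] := unliftP ord0 i.
  have -> : @tcons R n @^-1` ((fun t => tnth t (lift ord0 j)) @^-1` A) =
      [set: mR] `*` ((fun t => tnth t j) @^-1` A).
    by apply/seteqP; split => -[x t] /=; rewrite tnthS//; case.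
  transitivity (normal_prob 0 1 [set: mR] *
      std_gaussian R n ((fun t => tnth t j) @^-1` A))%E.
    by apply: product_measure1E => //; exact: measurable_tnth_preimage.
  by rewrite N1 mul1e; exact: ih.
have -> : @tcons R n @^-1` ((fun t => tnth t ord0) @^-1` A) = A `*` setT.
  by apply/seteqP; split => -[x t] //= -[].
transitivity (normal_prob (0 : R) 1 A * std_gaussian R n [set: n.-tuple mR])%E.
  exact: product_measure1E.
by rewrite probability_setT mule1.
Qed.

Variables n m : nat.
Local Notation G := (std_gaussian R n \x std_gaussian R m)%E.

Lemma joint_marginal1 (i : 'I_n) (A : set mR) : measurable A ->
  G ((fun w => tnth w.1 i) @^-1` A) = normal_prob (0 : R) 1 A.
Proof.
move=> mA.
have -> : (fun w : n.-tuple mR * m.-tuple mR => tnth w.1 i) @^-1` A =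
    ((fun t => tnth t i) @^-1` A) `*` setT.
  by apply/seteqP; split => -[u v] //= -[].
transitivity (std_gaussian R n ((fun t => tnth t i) @^-1` A) *
    std_gaussian R m [set: m.-tuple mR])%E.
  by apply: product_measure1E => //; exact: measurable_tnth_preimage.
by rewrite probability_setT mule1 std_gaussian_marginal.
Qed.

Lemma joint_marginal2 (i : 'I_m) (A : set mR) : measurable A ->
  G ((fun w => tnth w.2 i) @^-1` A) = normal_prob (0 : R) 1 A.
Proof.
move=> mA.
have -> : (fun w : n.-tuple mR * m.-tuple mR => tnth w.2 i) @^-1` A =
    setT `*` ((fun t => tnth t i) @^-1` A).
  by apply/seteqP; split => -[u v] //= -[].
transitivity (std_gaussian R n [set: n.-tuple mR] *
    std_gaussian R m ((fun t => tnth t i) @^-1` A))%E.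
  by apply: product_measure1E => //; exact: measurable_tnth_preimage.
by rewrite probability_setT mul1e std_gaussian_marginal.
Qed.

End gaussian_marginals.

(** * Bounds for functions of class C^1 and C^2 *)

Section mollification_bounds.
Context d (T : measurableType d) (R : realType) (P : probability T R).
Context (k : nat) (W : T -> 'rV[R]_k) (s : R).
Hypothesis k0 : (0 < k)%N.
Hypothesis mW : forall i, measurable_fun [set: T] (fun t => W t 0 i).
Hypothesis iW4 : forall i, P.-integrable [set: T] (fun t => (W t 0 i ^+ 4)%:E).
Hypothesis s0 : 0 < s.
Hypothesis W2 : \int[P]_t (enorm (W t) ^+ 2) <= s ^+ 2.
Hypothesis W1 : forall i, \int[P]_t (W t 0 i) = 0.
Implicit Types (f q : 'rV[R]_k -> R) (x y z e v : 'rV[R]_k) (L : R).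
Local Notation sm := (mollify P W).

Lemma mollify_derive_classC1 L f : classC1 L f ->
  (forall z, differentiable (sm f) z) /\
  (forall e, 'D_e (sm f) = sm ('D_e f)).
Proof.
move=> Cf; have L0 := classC1_ge0 k0 Cf; have [df _] := Cf.
have h z := mollify_differentiable mW iW4 df L0 (classC1_grad_growth L0 Cf) z.
by split => [z|e]; [have [] := h z|apply/funext => z; have [_] := h z].
Qed.

Lemma mollify_grad_dist f e z : differentiable f z -> differentiable (sm f) z ->
  'D_e (sm f) = sm ('D_e f) ->
  dot (grad (sm f) z - grad f z) e = sm ('D_e f) z - 'D_e f z.
Proof.
move=> df dsf E; rewrite dotBl; congr (_ - _); last exact/esym/derive_grad.
by rewrite -E; exact/esym/derive_grad.
Qed.

(** The gradient bound is [mollify_classC0] for the directional derivatives of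
    [f], which are Lipschitz. *)
Lemma mollify_bounds_classC1 L f z : classC1 L f ->
  [/\ P.-integrable [set: T] (EFin \o (fun t => f (z + W t))),
      `|sm f z - f z| <= L / 2 * s ^+ 2,
      differentiable (sm f) z &
      enorm (grad (sm f) z - grad f z) <= L * s].
Proof.
move=> Cf; have L0 := classC1_ge0 k0 Cf; have [df _] := Cf.
have [dsm Dsm] := mollify_derive_classC1 Cf.
have iS : P.-integrable [set: T] (EFin \o (fun t => f (z + W t))).
  exact: (integrable_shift_f mW iW4 df L0 (classC1_grad_growth L0 Cf)).
split => //; first exact: (mollify_classC1 mW iW4 W2 W1 L0 Cf iS).
apply: enorm_dual => [|e]; first by rewrite mulr_ge0// ltW.
rewrite mollify_grad_dist// (le_trans (ler_norm _))// mulrAC.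
apply: (mollify_classC0 mW iW4 s0 W2 _ _ (classC1_derive e Cf)).2.
by rewrite mulr_ge0 ?enorm_ge0.
Qed.

(** The gradient bound is the value bound of [mollify_bounds_classC1] for
    ['D_e q], and the Hessian bound is [mollify_classC0] for
    ['D_v ('D_e q)]. *)
Lemma mollify_bounds_classC2 L q z : classC2 L q ->
  [/\ P.-integrable [set: T] (EFin \o (fun t => q (z + W t))),
      differentiable (sm q) z,
      enorm (grad (sm q) z - grad q z) <= L / 2 * s ^+ 2,
      differentiable (grad (sm q)) z &
      opnorm (hessian (sm q) z - hessian q z) <= L * s].
Proof.
move=> Cq; have L0 := classC2_ge0 k0 Cq; have [dq dgq _] := Cq.
have [K K0 Kq] := classC2_grad_growth k0 Cq.
have CD e := classC2_derive e k0 Cq.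
have dsm x : differentiable (sm q) x.
  by have [] := mollify_differentiable mW iW4 dq K0 Kq x.
have Dsm e : 'D_e (sm q) = sm ('D_e q).
  by apply/funext => x; have [_] := mollify_differentiable mW iW4 dq K0 Kq x.
have DDsm v e : 'D_v ('D_e (sm q)) = sm ('D_v ('D_e q)).
  by rewrite Dsm; have [_] := mollify_derive_classC1 (CD e).
have dgsm x : differentiable (grad (sm q)) x.
  apply: differentiable_coords => i.
  have -> : (fun y => grad (sm q) y 0 i) = sm ('D_(delta_mx 0 i) q).
    by apply/funext => y; rewrite mxE -Dsm.
  by have [] := mollify_derive_classC1 (CD (delta_mx 0 i)).
split => //.
- exact: (integrable_shift_f mW iW4 dq K0 Kq).
- apply: enorm_dual => [|e]; first by rewrite mulr_ge0 ?sqr_ge0// divr_ge0.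
  rewrite mollify_grad_dist// (le_trans (ler_norm _))//.
  have [iS h _ _] := mollify_bounds_classC1 z (CD e).
  by rewrite (le_trans h)// le_eqVlt; apply/orP; left; apply/eqP; ring.
- apply: opnorm_le => [|v e]; first by rewrite mulr_ge0// ltW.
  have -> : dot (v *m (hessian (sm q) z - hessian q z)) e =
      sm ('D_v ('D_e q)) z - 'D_v ('D_e q) z.
    rewrite mulmxBr dotBl -DDsm.
    by congr (_ - _); apply/esym; exact: derive2_hessian.
  rewrite (le_trans (ler_norm _))//.
  have Le0 : 0 <= L * enorm v * enorm e by rewrite !mulr_ge0 ?enorm_ge0.
  have [_ h] := mollify_classC0 mW iW4 s0 W2 z Le0 (classC2_derive2 v e Cq).
  by rewrite (le_trans h)// le_eqVlt; apply/orP; left; apply/eqP; ring.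
Qed.

End mollification_bounds.

(** * Gaussian smoothing *)

Section gaussian_noise.
Context (R : realType) (n m : nat) (eta mu : R).
Local Notation mR := (measurableTypeR R).
Local Notation G := (std_gaussian R n \x std_gaussian R m)%E.

Definition gaussian_noise (w : n.-tuple mR * m.-tuple mR) : 'rV[R]_(n + m) :=
  row_mx (eta *: rowt w.1) (mu *: rowt w.2).

Lemma perturbedE (q : 'rV[R]_(n + m) -> R) z w :
  perturbed q eta mu z w = q (z + gaussian_noise w).
Proof. by rewrite /perturbed -[in RHS](hsubmxK z) add_row_mx. Qed.

Lemma smoothingE (q : 'rV[R]_(n + m) -> R) :
  smoothing q eta mu = mollify G gaussian_noise q.
Proof.
by apply/funext => z; apply: eq_Rintegral => w _; rewrite perturbedE.
Qed.

Lemma gaussian_noise_l w (j : 'I_n) :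
  gaussian_noise w 0 (lshift m j) = eta * tnth w.1 j.
Proof. by rewrite row_mxEl !mxE. Qed.

Lemma gaussian_noise_r w (j : 'I_m) :
  gaussian_noise w 0 (rshift n j) = mu * tnth w.2 j.
Proof. by rewrite row_mxEr !mxE. Qed.

Let m1 (j : 'I_n) :
  measurable_fun [set: n.-tuple mR * m.-tuple mR] (fun w => tnth w.1 j : mR).
Proof. exact: (measurableT_comp (measurable_tnth j) measurable_fst). Qed.

Let m2 (j : 'I_m) :
  measurable_fun [set: n.-tuple mR * m.-tuple mR] (fun w => tnth w.2 j : mR).
Proof. exact: (measurableT_comp (measurable_tnth j) measurable_snd). Qed.

Lemma measurable_gaussian_noise i :
  measurable_fun [set: n.-tuple mR * m.-tuple mR] (fun w => gaussian_noise w 0 i).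
Proof.
have [j ->|j ->] := split_ordP i.
- under eq_fun do rewrite gaussian_noise_l.
  by apply: measurable_funM => //; exact: m1.
- under eq_fun do rewrite gaussian_noise_r.
  by apply: measurable_funM => //; exact: m2.
Qed.

Lemma gaussian_noise_fourth i :
  G.-integrable [set: n.-tuple mR * m.-tuple mR]
    (fun w => (gaussian_noise w 0 i ^+ 4)%:E).
Proof.
have [j ->|j ->] := split_ordP i.
- under eq_fun do rewrite gaussian_noise_l exprMn.
  exact/integrableZ_fun/(integrable_normal4 (m1 j))/joint_marginal1.
- under eq_fun do rewrite gaussian_noise_r exprMn.
  exact/integrableZ_fun/(integrable_normal4 (m2 j))/joint_marginal2.
Qed.

Lemma gaussian_noise_mean i : \int[G]_w (gaussian_noise w 0 i) = 0.
Proof.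
have [j ->|j ->] := split_ordP i.
- under eq_Rintegral do rewrite gaussian_noise_l.
  have law := @joint_marginal1 R n m j.
  rewrite RintegralZl//; last exact: (integrable_normal (m1 j) law).
  by rewrite (expect_normal (m1 j) law) mulr0.
- under eq_Rintegral do rewrite gaussian_noise_r.
  have law := @joint_marginal2 R n m j.
  rewrite RintegralZl//; last exact: (integrable_normal (m2 j) law).
  by rewrite (expect_normal (m2 j) law) mulr0.
Qed.

Lemma gaussian_noise_second :
  \int[G]_w (enorm (gaussian_noise w) ^+ 2) <= eta ^+ 2 * n%:R + mu ^+ 2 * m%:R.
Proof.
have law1 j := @joint_marginal1 R n m j; have law2 j := @joint_marginal2 R n m j.
have i1 j := integrable_normal2 (m1 j) (law1 j).
have i2 j := integrable_normal2 (m2 j) (law2 j).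
pose S1 (w : n.-tuple mR * m.-tuple mR) : R := \sum_(j < n) eta ^+ 2 * tnth w.1 j ^+ 2.
pose S2 (w : n.-tuple mR * m.-tuple mR) : R := \sum_(j < m) mu ^+ 2 * tnth w.2 j ^+ 2.
have -> : (fun w => enorm (gaussian_noise w) ^+ 2) = (fun w => S1 w + S2 w).
  apply/funext => w; rewrite enorm_sqr /dot big_split_ord /=.
  by congr (_ + _); apply: eq_bigr => j _;
    rewrite ?gaussian_noise_l ?gaussian_noise_r -expr2 exprMn.
have iS1 j : G.-integrable setT (EFin \o (fun w => eta ^+ 2 * tnth w.1 j ^+ 2)).
  exact: (integrableZ_fun (eta ^+ 2) (i1 j)).
have iS2 j : G.-integrable setT (EFin \o (fun w => mu ^+ 2 * tnth w.2 j ^+ 2)).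
  exact: (integrableZ_fun (mu ^+ 2) (i2 j)).
rewrite RintegralD//; [|exact: integrable_sum_fun|exact: integrable_sum_fun].
have sumE (c : R) p : c * p%:R = \sum_(j < p) c.
  by rewrite sumr_const card_ord mulr_natr.
rewrite !expect_sum// !sumE.
apply: lerD; apply: ler_sum => j _.
  rewrite RintegralZl//; last exact: (i1 j).
  by rewrite ler_piMr ?sqr_ge0//; exact: (expect_normal2 (m1 j) (law1 j)).
rewrite RintegralZl//; last exact: (i2 j).
by rewrite ler_piMr ?sqr_ge0//; exact: (expect_normal2 (m2 j) (law2 j)).
Qed.

End gaussian_noise.

Section numeric_bounds.
Context (R : realType).
Implicit Types (a b c p : R).

Lemma powR_half a : 0 <= a -> a `^ (1 / 2) = Num.sqrt a.
Proof. by move=> a0; rewrite mul1r powR12_sqrt. Qed.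

(** [2 sqrt a <= a + 1 <= a + c <= (a + c)^p]. *)
Lemma sqrt_le_powR a c p : 0 <= a -> 1 <= c -> 1 <= p ->
  2 * Num.sqrt a <= (a + c) `^ p.
Proof.
move=> a0 c1 p1; apply: (@le_trans _ _ (a + c)).
  have := sqr_ge0 (Num.sqrt a - 1); rewrite sqrrB sqr_sqrtr//; lra.
rewrite -{1}[a + c]powRr1 ?ler_powR//; lra.
Qed.

Lemma sqrt_hypot_le a b : 0 <= a -> 0 <= b ->
  Num.sqrt (a ^+ 2 + b ^+ 2) <= a + b.
Proof.
move=> a0 b0; rewrite -(@ger0_norm _ (a + b)) ?addr_ge0// -sqrtr_sqr.
rewrite ler_wsqrtr// sqrrD; have := mulr_ge0 a0 b0; lra.
Qed.

End numeric_bounds.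

Theorem proposition2p2 (R : realType) (n m : nat) (hn : (1 <= n)%N)
    (hm : (1 <= m)%N) (q : 'rV[R]_(n + m) -> R) (eta mu : R)
    (heta : 0 < eta) (hmu : 0 < mu) (x : 'rV[R]_n) (y : 'rV[R]_m) :
  let N : R := n%:R in
  let M : R := m%:R in
  let z : 'rV[R]_(n + m) := row_mx x y in
  let qs : 'rV[R]_(n + m) -> R := smoothing q eta mu in
  (forall L0 : R, classC0 L0 q ->
     smoothable q eta mu z /\
     `|qs z - q z| <= L0 * (eta ^+ 2 * N + mu ^+ 2 * M) `^ (1 / 2))
  /\
  (forall L1 : R, classC1 L1 q ->
     let Ux1 : R := L1 / 2 *
       (eta * (N + 3) `^ (3 / 2) + mu ^+ 2 / eta * M * N `^ (1 / 2)) in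
     let Uy1 : R := L1 / 2 *
       (eta ^+ 2 / mu * N * M `^ (1 / 2) + mu * (M + 3) `^ (3 / 2)) in
     [/\ smoothable q eta mu z,
         `|qs z - q z| <= L1 / 2 * (eta ^+ 2 * N + mu ^+ 2 * M),
         differentiable qs z &
         enorm (grad qs z - grad q z) <= Ux1 + Uy1])
  /\
  (forall L2 : R, classC2 L2 q ->
     let Ux2 : R := 2 * L2 / 3 *
       (eta ^+ 2 * (N + 4) ^+ 2
        + mu ^+ 3 / eta * (M + 3) `^ (3 / 2) * N `^ (1 / 2)) in
     let Uy2 : R := 2 * L2 / 3 *
       (eta ^+ 3 / mu * (N + 3) `^ (3 / 2) * M `^ (1 / 2)
        + mu ^+ 2 * (M + 4) ^+ 2) in
     let Uxx2 : R := 2 * L2 / 3 *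
       (eta * (N + 5) `^ (5 / 2) + eta * (N + 3) `^ (3 / 2)
        + mu ^+ 3 / eta ^+ 2 * (N + 1) * (M + 3) `^ (3 / 2)) in
     let Uyy2 : R := 2 * L2 / 3 *
       (mu * (M + 5) `^ (5 / 2) + mu * (M + 3) `^ (3 / 2)
        + eta ^+ 3 / mu ^+ 2 * (M + 1) * (N + 3) `^ (3 / 2)) in
     let Uxy2 : R := 2 * L2 / 3 *
       (eta ^+ 2 / mu * (N + 4) ^+ 2 * M `^ (1 / 2)
        + mu ^+ 2 / eta * (M + 4) ^+ 2 * N `^ (1 / 2)) in
     [/\ smoothable q eta mu z,
         differentiable qs z,
         enorm (grad qs z - grad q z) <= Ux2 + Uy2,
         differentiable (grad qs) z &
         opnorm (hessian qs z - hessian q z) <= Uxx2 + Uxy2 + Uyy2]).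

Proof.
move=> N M z qs.
have N0 : 0 <= N by rewrite ler0n.
have M0 : 0 <= M by rewrite ler0n.
have N1 : 1 <= N by rewrite ler1n.
have e0 := ltW heta; have u0 := ltW hmu.
pose s := Num.sqrt (eta ^+ 2 * N + mu ^+ 2 * M).
have p32 : 1 <= 3 / 2 :> R by lra.
have p52 : 1 <= 5 / 2 :> R by lra.
have c3 : 1 <= 3 :> R by lra.
have c5 : 1 <= 5 :> R by lra.
have v0 : 0 < eta ^+ 2 * N + mu ^+ 2 * M.
  by rewrite ltr_pwDl ?mulr_ge0 ?sqr_ge0// mulr_gt0 ?exprn_gt0// (lt_le_trans ltr01).
have s0 : 0 < s by rewrite sqrtr_gt0.
have s2 : s ^+ 2 = eta ^+ 2 * N + mu ^+ 2 * M by rewrite sqr_sqrtr// ltW.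
have k0 : (0 < n + m)%N by rewrite addn_gt0 hn.
have mW := @measurable_gaussian_noise R n m eta mu.
have iW4 := @gaussian_noise_fourth R n m eta mu.
have W1 := @gaussian_noise_mean R n m eta mu.
have W2 := @gaussian_noise_second R n m eta mu.
rewrite -/N -/M -s2 in W2.
have qsE : qs = _ := smoothingE eta mu q.
have smoothableE : smoothable q eta mu z =
    (std_gaussian R n \x std_gaussian R m)%E.-integrable setT
      (EFin \o (fun w => q (z + gaussian_noise eta mu w))).
  rewrite /smoothable; congr (integrable _ _ _).
  by apply/funext => w; rewrite /= perturbedE.
rewrite smoothableE qsE.
have sN := sqrtr_ge0 N; have sM := sqrtr_ge0 M.
have sle : s <= eta * Num.sqrt N + mu * Num.sqrt M.
  apply: le_trans (sqrt_hypot_le (mulr_ge0 e0 sN) (mulr_ge0 u0 sM)).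
  by rewrite !exprMn !sqr_sqrtr.
split; [|split] => L CL.
- have L0 := classC0_ge0 k0 CL; rewrite powR_half ?(ltW v0)//.
  exact: (mollify_classC0 mW iW4 s0 W2 z L0 CL).
- have L0 := classC1_ge0 k0 CL.
  have [h1 h2 h3 h4] := mollify_bounds_classC1 k0 mW iW4 s0 W2 W1 z CL.
  split => //; first by rewrite -s2.
  (* the leading terms alone dominate [L s]; the others are nonnegative *)
  have pN : 2 * Num.sqrt N <= (N + 3) `^ (3 / 2) by exact: sqrt_le_powR.
  have pM : 2 * Num.sqrt M <= (M + 3) `^ (3 / 2) by exact: sqrt_le_powR.
  have t1 : 0 <= mu ^+ 2 / eta * M * N `^ (1 / 2).
    by rewrite !mulr_ge0 ?powR_ge0 ?sqr_ge0 ?invr_ge0.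
  have t2 : 0 <= eta ^+ 2 / mu * N * M `^ (1 / 2).
    by rewrite !mulr_ge0 ?powR_ge0 ?sqr_ge0 ?invr_ge0.
  have k1 := ler_wpM2l e0 pN; have k2 := ler_wpM2l u0 pM.
  apply: (le_trans h4); rewrite -mulrDr mulrAC -mulrA ler_wpM2l//; lra.
have L0 := classC2_ge0 k0 CL.
have [h1 h2 h3 h4 h5] := mollify_bounds_classC2 k0 mW iW4 s0 W2 W1 z CL.
split => //.
- have t1 : 0 <= mu ^+ 3 / eta * (M + 3) `^ (3 / 2) * N `^ (1 / 2).
    by rewrite !mulr_ge0 ?powR_ge0 ?exprn_ge0 ?invr_ge0.
  have t2 : 0 <= eta ^+ 3 / mu * (N + 3) `^ (3 / 2) * M `^ (1 / 2).
    by rewrite !mulr_ge0 ?powR_ge0 ?exprn_ge0 ?invr_ge0.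
  have k1 : eta ^+ 2 * N <= eta ^+ 2 * (N + 4) ^+ 2.
    by rewrite ler_wpM2l ?sqr_ge0//; nra.
  have k2 : mu ^+ 2 * M <= mu ^+ 2 * (M + 4) ^+ 2.
    by rewrite ler_wpM2l ?sqr_ge0//; nra.
  have q1 : 0 <= eta ^+ 2 * N by rewrite mulr_ge0 ?sqr_ge0.
  have q2 : 0 <= mu ^+ 2 * M by rewrite mulr_ge0 ?sqr_ge0.
  apply: (le_trans h3); rewrite s2 -mulrDr (mulrC 2 L) -!mulrA ler_wpM2l//; lra.
have pN : 2 * Num.sqrt N <= (N + 5) `^ (5 / 2) by exact: sqrt_le_powR.
have pM : 2 * Num.sqrt M <= (M + 5) `^ (5 / 2) by exact: sqrt_le_powR.
have k1 := ler_wpM2l e0 pN; have k2 := ler_wpM2l u0 pM.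
have t1 : 0 <= eta * (N + 3) `^ (3 / 2) by rewrite mulr_ge0 ?powR_ge0.
have t2 : 0 <= mu * (M + 3) `^ (3 / 2) by rewrite mulr_ge0 ?powR_ge0.
have t3 : 0 <= mu ^+ 3 / eta ^+ 2 * (N + 1) * (M + 3) `^ (3 / 2).
  by rewrite !mulr_ge0 ?powR_ge0 ?exprn_ge0 ?invr_ge0 ?exprn_ge0 ?addr_ge0.
have t4 : 0 <= eta ^+ 3 / mu ^+ 2 * (M + 1) * (N + 3) `^ (3 / 2).
  by rewrite !mulr_ge0 ?powR_ge0 ?exprn_ge0 ?invr_ge0 ?exprn_ge0 ?addr_ge0.
have t5 : 0 <= eta ^+ 2 / mu * (N + 4) ^+ 2 * M `^ (1 / 2).
  by rewrite !mulr_ge0 ?powR_ge0 ?sqr_ge0 ?invr_ge0 ?addr_ge0.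
have t6 : 0 <= mu ^+ 2 / eta * (M + 4) ^+ 2 * N `^ (1 / 2).
  by rewrite !mulr_ge0 ?powR_ge0 ?sqr_ge0 ?invr_ge0 ?addr_ge0.
apply: (le_trans h5); rewrite -!mulrDr (mulrC 2 L) -!mulrA ler_wpM2l//; lra.
Qed.
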